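(* There is a computably enumerable set $A\subseteq\omega$ that is intermediate for $\Delta$-Feiner.
   Context: $X^{(m)}$ denotes the $m$th Turing jump of $X$, with $X^{(-1)}=X^{(0)}=X$. Fix $a,b\in\omega$ with $b\geq 1$. For $X\subseteq\omega$, a set $S\subseteq\omega$ is $\Delta^0_{(bn+a)}(X)$ if there is a single Turing functional $\Phi_e$ such that for all $n$, $\Phi_e^{X^{(bn+a-1)}}(n)$ converges, with value $1$ if $n\in S$ and $0$ if $n\notin S$. A set $X$ is low for $\Delta^0_{(bn+a)}$ if every $S$ that is $\Delta^0_{(bn+a)}(X)$ is also $\Delta^0_{(bn+a)}(\emptyset)$; it is high for $\Delta^0_{(bn+a)}$ if every $S$ that is $\Delta^0_{(bn+a)}(\emptyset')$ is also $\Delta^0_{(bn+a)}(X)$; it is intermediate for $\Delta^0_{(bn+a)}$ if it is neither low nor high for $\Delta^0_{(bn+a)}$. A set is intermediate for $\Delta$-Feiner if it is intermediate for $\Delta^0_{(bn+a)}$ for some $a,b\in\omega$ with $b\geq 1$. *)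

(* Defs.v *)
From Stdlib Require Import Arith Cantor.

(* Turing functionals are presented as programs for partial recursive functions
   with an oracle.  All functions are unary; several arguments are packed with
   the Cantor pairing of the standard library. *)

Inductive code : Type :=
| Zero
| Succ
| Fst
| Snd
| Oracle
| Pair (f g : code)
| Comp (f g : code)
| Prec (f g : code)
| Mu (f : code).

Notation pair_nat x y := (Cantor.to_nat (x, y)).

(* Graph of h given by h 0 = F and h (k+1) = G k (h k), for partial F and G. *)
Fixpoint prec_graph (F : nat -> Prop) (G : nat -> nat -> nat -> Prop)
    (n y : nat) : Prop :=
  match n with
  | 0 => F y
  | S k => exists r, prec_graph F G k r /\ G k r y
  end.

(* [eval X c x y]: with oracle X, program c halts on input x with output y.
   [Prec f g] sends <a, n> to h n with h 0 = f a, h (k+1) = g <a, <k, h k>>.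
   [Mu f] sends x to the least y with f <x, y> = 0, and diverges if f diverges
   at some <x, z> met before. *)
Fixpoint eval (X : nat -> Prop) (c : code) (x y : nat) : Prop :=
  match c with
  | Zero => y = 0
  | Succ => y = S x
  | Fst => y = fst (Cantor.of_nat x)
  | Snd => y = snd (Cantor.of_nat x)
  | Oracle => (X x /\ y = 1) \/ (~ X x /\ y = 0)
  | Pair f g => exists u v, eval X f x u /\ eval X g x v /\ y = pair_nat u v
  | Comp f g => exists u, eval X g x u /\ eval X f u y
  | Prec f g =>
      let a := fst (Cantor.of_nat x) in
      let n := snd (Cantor.of_nat x) in
      prec_graph (eval X f a)
        (fun k r => eval X g (pair_nat a (pair_nat k r))) n y
  | Mu f =>
      eval X f (pair_nat x y) 0 /\
      forall z, z < y -> exists v, eval X f (pair_nat x z) (S v)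
  end.

Fixpoint encode (c : code) : nat :=
  match c with
  | Zero => pair_nat 0 0
  | Succ => pair_nat 1 0
  | Fst => pair_nat 2 0
  | Snd => pair_nat 3 0
  | Oracle => pair_nat 4 0
  | Pair f g => pair_nat 5 (pair_nat (encode f) (encode g))
  | Comp f g => pair_nat 6 (pair_nat (encode f) (encode g))
  | Prec f g => pair_nat 7 (pair_nat (encode f) (encode g))
  | Mu f => pair_nat 8 (encode f)
  end.

(* [Phi e X x y] is Phi_e^X(x) = y.  A number that codes no program is an index
   of the nowhere defined functional. *)
Definition Phi (e : nat) (X : nat -> Prop) (x y : nat) : Prop :=
  exists c, encode c = e /\ eval X c x y.

Lemma encode_inj (c d : code) : encode c = encode d -> c = d.
Proof.
  revert d; induction c; intros []; cbn [encode]; intros H;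
    apply Cantor.to_nat_inj in H; try discriminate H; try reflexivity;
    apply (f_equal snd) in H; cbn [snd] in H;
    try (apply Cantor.to_nat_inj in H;
         pose proof (f_equal fst H) as H1; pose proof (f_equal snd H) as H2;
         cbn [fst snd] in H1, H2);
    f_equal; auto.
Qed.

Lemma eval_functional (X : nat -> Prop) (c : code) (x y y' : nat) :
  eval X c x y -> eval X c x y' -> y = y'.
Proof.
  revert x y y'; induction c; cbn [eval]; intros x y y' H H';
    try congruence.
  - destruct H as [[]|[]], H' as [[]|[]]; congruence || tauto.
  - destruct H as (u & v & Hu & Hv & ->), H' as (u' & v' & Hu' & Hv' & ->).
    rewrite (IHc1 _ _ _ Hu Hu'), (IHc2 _ _ _ Hv Hv'); reflexivity.
  - destruct H as (u & Hu & H), H' as (u' & Hu' & H').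
    rewrite (IHc2 _ _ _ Hu Hu') in H; eauto.
  - cbv zeta in H, H'.
    revert y y' H H'; induction (snd (Cantor.of_nat x)) as [|n IHn];
      cbn [prec_graph]; intros y y' H H'; [eauto|].
    destruct H as (r & Hr & H), H' as (r' & Hr' & H').
    rewrite (IHn _ _ Hr Hr') in H; eauto.
  - destruct H as [H L], H' as [H' L'].
    destruct (lt_eq_lt_dec y y') as [[l|e]|l]; [|exact e|].
    + destruct (L' _ l) as [v Hv]; discriminate (IHc _ _ _ H Hv).
    + destruct (L _ l) as [v Hv]; discriminate (IHc _ _ _ H' Hv).
Qed.

Lemma Phi_functional (e : nat) (X : nat -> Prop) (x y y' : nat) :
  Phi e X x y -> Phi e X x y' -> y = y'.
Proof.
  intros (c & Hc & H) (d & Hd & H').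
  rewrite <- Hd in Hc; apply encode_inj in Hc; subst d.
  exact (eval_functional _ _ _ _ _ H H').
Qed.

Definition emptyset : nat -> Prop := fun _ => False.

Definition jump (X : nat -> Prop) : nat -> Prop :=
  fun e => exists y, Phi e X e y.

Definition jumps (m : nat) (X : nat -> Prop) : nat -> Prop :=
  Nat.iter m jump X.

Definition computably_enumerable (A : nat -> Prop) : Prop :=
  exists e, forall n, A n <-> exists y, Phi e emptyset n y.

(* S is Delta^0_{(bn+a)}(X).  Subtraction on nat is truncated, which agrees
   with the convention X^(-1) = X^(0) = X. *)
Definition Delta (a b : nat) (X S : nat -> Prop) : Prop :=
  exists e, forall n,
    (S n -> Phi e (jumps (b * n + a - 1) X) n 1) /\
    (~ S n -> Phi e (jumps (b * n + a - 1) X) n 0).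

Definition low_for_Delta (a b : nat) (X : nat -> Prop) : Prop :=
  forall S, Delta a b X S -> Delta a b emptyset S.

Definition high_for_Delta (a b : nat) (X : nat -> Prop) : Prop :=
  forall S, Delta a b (jump emptyset) S -> Delta a b X S.

Definition intermediate_for_Delta (a b : nat) (X : nat -> Prop) : Prop :=
  ~ low_for_Delta a b X /\ ~ high_for_Delta a b X.

Definition intermediate_for_Delta_Feiner (X : nat -> Prop) : Prop :=
  exists a b, 1 <= b /\ intermediate_for_Delta a b X.

(* Main.v *)
From Stdlib Require Import Arith Lia Cantor ClassicalEpsilon.
From Stdlib Require Import FunctionalExtensionality PropExtensionality.
Require Import Defs.

(** The parameters are [a = b = 1], so that level [n] of the uniform hierarchy
    over [X] looks at the [n]th jump of [X].

    Write [0^(m)] for the [m]th jump of the empty set.  The idea is to build all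
    the jumps of the c.e. set at once, as a tower of sets [A_m], each c.e. in
    [0^(m)] by one and the same program [c] on input [<m, x>], such that the jump
    of [A_m (+) 0^(m)] has the degree of [A_(m+1) (+) 0^(m+1)], uniformly in [m].
    The construction of [A_m] from [0^(m)] is the inversion of the jump for a
    target c.e. in the jump, and it needs the target [A_(m+1)] only through an
    index, so the recursion theorem ([recursion_theorem], [self_reference])
    supplies [c].  By induction [A_0^(m)] and [A_m (+) 0^(m)] compute each other
    uniformly in [m] ([jumps_from_tower], [tower_from_jumps]), and [A_0] is
    controlled at level [m] by what is done to [A_m], where one bit of freedom
    is enough:

    - [A_n] contains [0] exactly if [Phi_n] with oracle [0^(n)] maps [n] to [0].
      The set of such [n] is therefore uniformly computable from the jumps of
      [A_0], and by diagonalization it is not so from the jumps of the empty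
      set: [A_0] is not low.
    - The question whether [Phi_n] with oracle [A_n (+) 0^(n)] maps [n] to [0] is
      given the highest priority in the construction of [A_n], which makes its
      answer computable from [0^(n+1)].  The set of such [n] is uniformly
      computable from the jumps of [0'] and, by diagonalization, not from the
      jumps of [A_0]: [A_0] is not high.

    At one level, with [X = 0^(m)], the set [A_m] is built by stages in columns.
    As [A_(m+1)] is c.e. in [X'], membership of [z] in it is a Sigma_2 question
    over [X]; accordingly column [z+1] of a set of targets, c.e. in [X], is
    finite if [z] is in [A_(m+1)], and full otherwise.  [A_m] takes almost all
    targets of each column ([thickness]), so the jump of [A_m (+) X] decodes
    [A_(m+1)] ([dec_next_tower]).  Requirement [e] asks to preserve a computation
    seen at some stage (the special question for [e = 0], the halting of
    [Phi_(e-1)] on [e-1] otherwise), by keeping the columns above [e] from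
    changing below its use.  Smaller columns may injure it infinitely often;
    a requirement is therefore heard only if its use does not exceed the
    number enumerated last.  At the stages with no smaller number to come
    ([true_stage]) only correct computations pass this test, so the restraint is
    finite along them, while a computation that agrees with [A_m] on the columns
    up to [e] lasts for ever ([preservation]).  Thus [A_(m+1) (+) X'] can find out,
    one requirement after the other, which requirements are satisfied, and this
    decides the jump of [A_m (+) X] ([verdict_satisfied], [dec_jump_tower]).

    All programs are obtained from closure properties of computability, among
    them a bounded universal evaluator ([ev]) that also keeps track of the use. *)

(** * Pairing and characteristic functions *)

Definition pfst (n : nat) : nat := fst (Cantor.of_nat n).
Definition psnd (n : nat) : nat := snd (Cantor.of_nat n).

Lemma pfst_pair x y : pfst (pair_nat x y) = x.
Proof. unfold pfst; now rewrite Cantor.cancel_of_to. Qed.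

Lemma psnd_pair x y : psnd (pair_nat x y) = y.
Proof. unfold psnd; now rewrite Cantor.cancel_of_to. Qed.

Lemma pair_surj n : pair_nat (pfst n) (psnd n) = n.
Proof.
  unfold pfst, psnd; rewrite <- surjective_pairing; apply Cantor.cancel_to_of.
Qed.

Global Opaque Cantor.to_nat Cantor.of_nat.

Lemma pair_le_sum x y : x + y <= pair_nat x y.
Proof. rewrite Nat.add_comm; apply Cantor.to_nat_non_decreasing. Qed.

Lemma psnd_le n : pfst n + psnd n <= n.
Proof. rewrite <- (pair_surj n) at 3; apply pair_le_sum. Qed.

Lemma pair_mono_r x y y' : y < y' -> pair_nat x y < pair_nat x y'.
Proof.
  intros H; pose proof (Cantor.to_nat_spec x y); pose proof (Cantor.to_nat_spec x y').
  nia.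
Qed.

Definition chi (P : Prop) : nat := if excluded_middle_informative P then 1 else 0.

Lemma chi_true (P : Prop) : P -> chi P = 1.
Proof. unfold chi; destruct excluded_middle_informative; tauto. Qed.

Lemma chi_false (P : Prop) : ~ P -> chi P = 0.
Proof. unfold chi; destruct excluded_middle_informative; tauto. Qed.

Lemma chi_iff (P Q : Prop) : (P <-> Q) -> chi P = chi Q.
Proof. unfold chi; repeat destruct excluded_middle_informative; tauto. Qed.

Lemma chi_1 (P : Prop) : chi P = 1 <-> P.
Proof.
  unfold chi; destruct excluded_middle_informative; split; intros; 
    (congruence || tauto).
Qed.

Lemma chi_0 (P : Prop) : chi P = 0 <-> ~ P.
Proof.
  unfold chi; destruct excluded_middle_informative; split; intros; 
    (congruence || tauto).
Qed.

(** * Computability relative to a context *)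

(** Computability uniform in an index: all indices are served by one program,
    which sees of the index [i] only the oracle [orc i] and the number [inp i].
    Indices may be oracles, numbers, or numbers subject to a condition, so
    uniformity in an oracle, in a level and in an index are one notion. *)
Record ctx : Type := Ctx { idx : Type; orc : idx -> nat -> Prop; inp : idx -> nat }.

Definition comp (C : ctx) (f : idx C -> nat) : Prop :=
  exists c, forall i, eval (orc C i) c (inp C i) (f i).

Definition dec (C : ctx) (P : idx C -> Prop) : Prop := comp C (fun i => chi (P i)).

Definition sd (C : ctx) (P : idx C -> Prop) : Prop :=
  exists c, forall i, P i <-> exists y, eval (orc C i) c (inp C i) y.

(** Serves to state the computability of functions of one more variable. *)
Definition ext (C : ctx) : ctx :=
  Ctx (idx C * nat) (fun p => orc C (fst p))
    (fun p => pair_nat (inp C (fst p)) (snd p)).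

(** The context of the step of a recursion: a position [k] and the value [f i k]
    reached there, which is the form in which [Prec] presents them. *)
Definition ext_val (C : ctx) (f : idx C -> nat -> nat) : ctx :=
  Ctx (idx C * nat) (fun p => orc C (fst p))
    (fun p => pair_nat (inp C (fst p)) (pair_nat (snd p) (f (fst p) (snd p)))).

Lemma comp_eq C (f g : idx C -> nat) : (forall i, f i = g i) -> comp C f -> comp C g.
Proof. intros E [c H]; exists c; intros i; rewrite <- E; apply H. Qed.

Lemma dec_iff C (P Q : idx C -> Prop) : (forall i, P i <-> Q i) -> dec C P -> dec C Q.
Proof. intros E; apply comp_eq; intros i; now apply chi_iff. Qed.

Lemma comp_inp C : comp C (inp C).
Proof.
  exists (Pair Fst Snd); intros i; cbn [eval]; do 2 eexists; repeat split.
  symmetry; apply pair_surj.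
Qed.

(** Substitution: a program for [f] can be run on an input that is itself
    computed. *)
Lemma comp_sub C C' (h : idx C' -> idx C) (f : idx C -> nat) :
  (forall i, orc C' i = orc C (h i)) ->
  comp C' (fun i => inp C (h i)) -> comp C f -> comp C' (fun i => f (h i)).
Proof.
  intros E [d D] [c H]; exists (Comp c d); intros i; cbn [eval].
  eexists; split; [apply D|]; rewrite E; apply H.
Qed.

Lemma comp_fun1 C c (F : nat -> nat) (f : idx C -> nat) :
  (forall X x, eval X c x (F x)) -> comp C f -> comp C (fun i => F (f i)).
Proof.
  intros H [d D]; exists (Comp c d); intros i; cbn [eval]; eauto.
Qed.

Fixpoint const_code (n : nat) : code :=
  match n with 0 => Zero | S k => Comp Succ (const_code k) end.

Lemma eval_const X n x : eval X (const_code n) x n.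
Proof. induction n; cbn [const_code eval]; eauto. Qed.

Lemma comp_const C n : comp C (fun _ => n).
Proof. exists (const_code n); intros; apply eval_const. Qed.

Lemma comp_S C f : comp C f -> comp C (fun i => S (f i)).
Proof. apply (comp_fun1 C Succ S); reflexivity. Qed.

Lemma comp_pfst C f : comp C f -> comp C (fun i => pfst (f i)).
Proof. apply (comp_fun1 C Fst pfst); reflexivity. Qed.

Lemma comp_psnd C f : comp C f -> comp C (fun i => psnd (f i)).
Proof. apply (comp_fun1 C Snd psnd); reflexivity. Qed.

Lemma comp_pair C f g :
  comp C f -> comp C g -> comp C (fun i => pair_nat (f i) (g i)).
Proof.
  intros [c H] [d D]; exists (Pair c d); intros i; cbn [eval]; eauto 6.
Qed.

Lemma dec_orc C f : comp C f -> dec C (fun i => orc C i (f i)).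
Proof.
  intros [c H]; exists (Comp Oracle c); intros i; cbn [eval]; eexists; split; [apply H|].
  unfold chi; destruct excluded_middle_informative; tauto.
Qed.

Lemma comp_var C : comp (ext C) (fun p => snd p).
Proof.
  exists Snd; intros p; cbn; symmetry; apply psnd_pair.
Qed.

Lemma comp_var_val C f : comp (ext_val C f) (fun p => snd p).
Proof.
  exists (Comp Fst Snd); intros p; cbn; eexists; split; [reflexivity|].
  symmetry; rewrite Cantor.cancel_of_to; cbn; now rewrite Cantor.cancel_of_to.
Qed.

Lemma comp_val C f : comp (ext_val C f) (fun p => f (fst p) (snd p)).
Proof.
  exists (Comp Snd Snd); intros p; cbn; eexists; split; [reflexivity|].
  symmetry; rewrite Cantor.cancel_of_to; cbn; now rewrite Cantor.cancel_of_to.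
Qed.

(** A function that ignores the new variable is computable if it was before;
    in this form the hypothesis is found by evaluation at [0] rather than by
    higher-order unification. *)
Lemma comp_ext C (g : idx C * nat -> nat) :
  (forall i n m, g (i, n) = g (i, m)) -> comp C (fun i => g (i, 0)) -> comp (ext C) g.
Proof.
  intros E H. apply (comp_eq (ext C) (fun p => g (fst p, 0))).
  { intros [i n]; apply E. }
  apply (comp_sub C (ext C) fst (fun i => g (i, 0))); auto.
  exists Fst; intros p; cbn; symmetry; apply pfst_pair.
Qed.

Lemma comp_ext_val C f (g : idx C * nat -> nat) :
  (forall i n m, g (i, n) = g (i, m)) -> comp C (fun i => g (i, 0)) ->
  comp (ext_val C f) g.
Proof.
  intros E H. apply (comp_eq (ext_val C f) (fun p => g (fst p, 0))).
  { intros [i n]; apply E. }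
  apply (comp_sub C (ext_val C f) fst (fun i => g (i, 0))); auto.
  exists Fst; intros p; cbn; symmetry; apply pfst_pair.
Qed.

Lemma comp_app C (f : idx C -> nat -> nat) n :
  comp (ext C) (fun p => f (fst p) (snd p)) -> comp C n -> comp C (fun i => f i (n i)).
Proof.
  intros H N. apply (comp_sub (ext C) C (fun i => (i, n i)) (fun p => f (fst p) (snd p))
    (fun i => eq_refl)); auto.
  cbn; apply comp_pair; auto using comp_inp.
Qed.

(** Course of a recursion: the step may use the previous value as an input, so
    it is enough to compute it along the true sequence of values. *)
Lemma comp_rec C (f : idx C -> nat -> nat) :
  comp C (fun i => f i 0) ->
  comp (ext_val C f) (fun p => f (fst p) (S (snd p))) ->
  comp (ext C) (fun p => f (fst p) (snd p)).
Proof.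
  intros [c H] [d D]; exists (Prec c d); intros [i n]; cbn.
  rewrite Cantor.cancel_of_to; cbn.
  induction n as [|n IH]; cbn; [apply H|].
  exists (f i n); split; [exact IH|]; apply (D (i, n)).
Qed.

(** Unbounded search for a number satisfying a decidable relation, with no
    promise that there is one. *)
Lemma search_code C (P : idx C -> nat -> Prop) :
  dec (ext C) (fun p => P (fst p) (snd p)) ->
  exists c, forall i y,
    eval (orc C i) c (inp C i) y <-> P i y /\ forall k, k < y -> ~ P i k.
Proof.
  intros H.
  assert (HP : comp (ext C) (fun p => 1 - chi (P (fst p) (snd p)))).
  (* [Mu] looks for a zero; the recursion of length [x] that starts with [1] and
     continues with [0] computes [1 - x]. *)
  { revert H; apply (comp_fun1 (ext C)
      (Comp (Prec (const_code 1) Zero) (Pair Zero (Pair Fst Snd))) (fun x => 1 - x)).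
    intros X x; cbn; eexists; split.
    { do 2 eexists; split; [reflexivity|]; split; [|reflexivity].
      do 2 eexists; repeat split. }
    rewrite Cantor.cancel_of_to; cbn. rewrite <- surjective_pairing, Cantor.cancel_to_of.
    destruct x as [|x]; cbn; [eauto|].
    enough (exists r, prec_graph (fun y => exists u, u = 0 /\ y = S u) (fun _ _ y => y = 0) x r)
      as [r Hr] by eauto.
    induction x; cbn; [eauto|]. destruct IHx; eauto. }
  destruct HP as [c HP]; exists (Mu c); intros i y; cbn [eval].
  assert (E0 : forall k, eval (orc C i) c (pair_nat (inp C i) k) 0 <-> P i k).
  { intros k; specialize (HP (i, k)); cbn in HP; split; intros Hk.
    - apply NNPP; intros N; rewrite chi_false in HP by auto.
      discriminate (eval_functional _ _ _ _ _ HP Hk).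
    - now rewrite chi_true in HP. }
  assert (E1 : forall k, (exists v, eval (orc C i) c (pair_nat (inp C i) k) (S v)) <-> ~ P i k).
  { intros k; specialize (HP (i, k)); cbn in HP; split.
    - intros [v Hv] N; rewrite chi_true in HP by auto.
      discriminate (eval_functional _ _ _ _ _ HP Hv).
    - intros N; rewrite chi_false in HP; eauto. }
  rewrite E0; apply and_iff_compat_l; split; intros L k Hk; now apply E1, L.
Qed.

Definition least (P : nat -> Prop) : nat :=
  epsilon (inhabits 0) (fun n => P n /\ forall k, k < n -> ~ P k).

Lemma least_spec (P : nat -> Prop) n :
  P n -> P (least P) /\ forall k, k < least P -> ~ P k.
Proof.
  intros H; unfold least; apply epsilon_spec.
  induction n as [n IH] using lt_wf_ind.
  destruct (classic (exists k, k < n /\ P k)) as [(k & Hk & Pk)|N]; [eauto|].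
  exists n; split; auto; intros k Hk Pk; eauto.
Qed.

Lemma comp_least C (P : idx C -> nat -> Prop) :
  dec (ext C) (fun p => P (fst p) (snd p)) ->
  (forall i, exists n, P i n) -> comp C (fun i => least (P i)).
Proof.
  intros HP HE; destruct (search_code C P HP) as [c H]; exists c; intros i; apply H.
  destruct (HE i) as [n Hn]; eapply least_spec; eauto.
Qed.

Lemma sd_ex C (P : idx C -> nat -> Prop) :
  dec (ext C) (fun p => P (fst p) (snd p)) -> sd C (fun i => exists n, P i n).
Proof.
  intros HP; destruct (search_code C P HP) as [c H]; exists c; intros i; split.
  - intros [n Hn]; exists (least (P i)); apply H; eapply least_spec; eauto.
  - intros [y Hy]; exists y; now apply H.
Qed.

(** * Elementary computable functions and relations *)

Lemma comp_rec_at C (f : idx C -> nat -> nat) n :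
  comp C (fun i => f i 0) ->
  comp (ext_val C f) (fun p => f (fst p) (S (snd p))) ->
  comp C n -> comp C (fun i => f i (n i)).
Proof. intros; apply comp_app; auto using comp_rec. Qed.

Lemma comp_pred C f : comp C f -> comp C (fun i => pred (f i)).
Proof.
  apply (comp_rec_at C (fun _ n => pred n)); cbn; [apply comp_const|apply comp_var_val].
Qed.

Lemma comp_add C f g : comp C f -> comp C g -> comp C (fun i => f i + g i).
Proof.
  intros Hf; apply (comp_rec_at C (fun i n => f i + n)).
  - now apply (comp_eq C f); [intros; lia|].
  - apply (comp_eq (ext_val C _) (fun p => S (f (fst p) + snd p))); [intros; lia|].
    apply comp_S, (comp_val C (fun i n => f i + n)).
Qed.

Lemma comp_sub_nat C f g : comp C f -> comp C g -> comp C (fun i => f i - g i).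
Proof.
  intros Hf; apply (comp_rec_at C (fun i n => f i - n)).
  - now apply (comp_eq C f); [intros; lia|].
  - apply (comp_eq (ext_val C _) (fun p => pred (f (fst p) - snd p))); [intros; lia|].
    apply comp_pred, (comp_val C (fun i n => f i - n)).
Qed.

Lemma comp_iter_psnd C f g :
  comp C f -> comp C g -> comp C (fun i => Nat.iter (g i) psnd (f i)).
Proof.
  intros Hf; apply (comp_rec_at C (fun i n => Nat.iter n psnd (f i))); [exact Hf|].
  cbn [Nat.iter nat_rect]; apply comp_psnd, (comp_val C (fun i n => Nat.iter n psnd (f i))).
Qed.

Lemma comp_encode_const C f : comp C f -> comp C (fun i => encode (const_code (f i))).
Proof.
  apply (comp_rec_at C (fun i n => encode (const_code n))); [apply comp_const|].
  cbn [const_code encode]; repeat apply comp_pair; try apply comp_const.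
  apply (comp_val C (fun i n => encode (const_code n))).
Qed.

Lemma dec_zero C f : comp C f -> dec C (fun i => f i = 0).
Proof.
  intros H; apply (comp_eq C (fun i => 1 - f i)).
  - intros i; destruct (f i); [now rewrite chi_true|rewrite chi_false; lia].
  - apply comp_sub_nat; auto using comp_const.
Qed.

Lemma dec_eq C f g : comp C f -> comp C g -> dec C (fun i => f i = g i).
Proof.
  intros; apply (dec_iff C (fun i => (f i - g i) + (g i - f i) = 0)); [intros; lia|].
  auto using dec_zero, comp_add, comp_sub_nat.
Qed.

Lemma dec_le C f g : comp C f -> comp C g -> dec C (fun i => f i <= g i).
Proof.
  intros; apply (dec_iff C (fun i => f i - g i = 0)); [intros; lia|].
  auto using dec_zero, comp_sub_nat.
Qed.

Lemma dec_lt C f g : comp C f -> comp C g -> dec C (fun i => f i < g i).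
Proof. intros; apply (dec_le C (fun i => S (f i))); auto using comp_S. Qed.

Lemma dec_not C P : dec C P -> dec C (fun i => ~ P i).
Proof.
  intros H; apply (dec_iff C (fun i => chi (P i) = 0)); [intros; apply chi_0|].
  now apply dec_zero.
Qed.

Lemma dec_or C P Q : dec C P -> dec C Q -> dec C (fun i => P i \/ Q i).
Proof.
  intros HP HQ; apply (dec_iff C (fun i => ~ (chi (P i) + chi (Q i) = 0))).
  - intros i; pose proof (chi_0 (P i)); pose proof (chi_0 (Q i)).
    rewrite Nat.eq_add_0; tauto.
  - now apply dec_not, dec_zero, comp_add.
Qed.

Lemma dec_and C P Q : dec C P -> dec C Q -> dec C (fun i => P i /\ Q i).
Proof.
  intros; apply (dec_iff C (fun i => ~ (~ P i \/ ~ Q i))); [intros; tauto|].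
  auto using dec_not, dec_or.
Qed.

Lemma dec_imp C P Q : dec C P -> dec C Q -> dec C (fun i => P i -> Q i).
Proof.
  intros; apply (dec_iff C (fun i => ~ P i \/ Q i)); [intros; tauto|].
  auto using dec_not, dec_or.
Qed.

Lemma dec_all C n (P : idx C -> nat -> Prop) :
  comp C n -> dec (ext C) (fun p => P (fst p) (snd p)) ->
  dec C (fun i => forall k, k < n i -> P i k).
Proof.
  intros Hn HP.
  apply (comp_rec_at C (fun i n => chi (forall k, k < n -> P i k))); auto.
  - apply (comp_eq C (fun _ => 1)); [|apply comp_const].
    intros i; rewrite chi_true; auto; lia.
  - apply (dec_iff (ext_val C _) (fun p => (forall k, k < snd p -> P (fst p) k) /\ P (fst p) (snd p))).
    { intros [i m]; cbn; split; [intros [H H'] k Hk|intros H; split; auto; intros; apply H; lia].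
      destruct (Nat.eq_dec k m) as [->|]; auto; apply H; lia. }
    apply dec_and; [apply (comp_val C (fun i n => chi (forall k, k < n -> P i k)))|].
    apply (comp_sub (ext C) (ext_val C _) (fun p => p) _ (fun _ => eq_refl)); [|exact HP].
    cbn; apply comp_pair; [|apply comp_var_val].
    apply comp_ext_val; auto; cbn [fst]; apply comp_inp.
Qed.

Lemma dec_ex C n (P : idx C -> nat -> Prop) :
  comp C n -> dec (ext C) (fun p => P (fst p) (snd p)) ->
  dec C (fun i => exists k, k < n i /\ P i k).
Proof.
  intros; apply (dec_iff C (fun i => ~ forall k, k < n i -> ~ P i k)).
  - intros i; split; [|firstorder].
    intros H'; apply NNPP; intros N; apply H'; intros k Hk HP; eauto.
  - apply dec_not, (dec_all C n (fun i k => ~ P i k)); auto using dec_not.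
Qed.

(** Variables and parameters, possibly belonging to an enclosing context. *)
Ltac comp_leaf :=
  cbn [fst snd];
  first [ eassumption
        | apply comp_inp
        | apply comp_var
        | apply comp_var_val
        | apply comp_val
        | apply comp_ext; [reflexivity | comp_leaf]
        | apply comp_ext_val; [reflexivity | comp_leaf] ].

(** Placeholders for the defined relations that are shown computable later. *)
Ltac comp_known_set := fail.
Ltac comp_known_eval := fail.
Ltac comp_known_stage := fail.

(** Computability by recursion on the expression.  A hypothesis that [Q] is
    decidable with one extra variable serves for every instance of [Q], also
    under more variables. *)
Ltac comp_step :=
  cbv beta;
  lazymatch goal with
  | |- comp _ (fun _ => ?k) => apply comp_const
  | |- comp ?C (fun i => S (@?f i)) => apply (comp_S C f)
  | |- comp ?C (fun i => pfst (@?f i)) => apply (comp_pfst C f)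
  | |- comp ?C (fun i => psnd (@?f i)) => apply (comp_psnd C f)
  | |- comp ?C (fun i => pred (@?f i)) => apply (comp_pred C f)
  | |- comp ?C (fun i => Cantor.to_nat (@?f i, @?g i)) => apply (comp_pair C f g)
  | |- comp ?C (fun i => @?f i + @?g i) => apply (comp_add C f g)
  | |- comp ?C (fun i => @?f i - @?g i) => apply (comp_sub_nat C f g)
  | |- comp ?C (fun i => encode (const_code (@?f i))) => apply (comp_encode_const C f)
  | |- comp ?C (fun i => chi (@?P i)) => change (dec C P)
  | |- dec ?C (fun i => @?f i = @?g i) => apply (dec_eq C f g)
  | |- dec ?C (fun i => @?f i <= @?g i) => apply (dec_le C f g)
  | |- dec ?C (fun i => @?f i < @?g i) => apply (dec_lt C f g)
  | |- dec ?C (fun i => ~ @?P i) => apply (dec_not C P)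
  | |- dec ?C (fun i => @?P i /\ @?Q i) => apply (dec_and C P Q)
  | |- dec ?C (fun i => @?P i \/ @?Q i) => apply (dec_or C P Q)
  | |- dec ?C (fun i => exists k, k < @?n i /\ @?P i k) => apply (dec_ex C n P)
  | |- dec ?C (fun i => forall k, k < @?n i -> @?P i k) => apply (dec_all C n P)
  | |- dec ?C (fun i => @?P i -> @?Q i) => apply (dec_imp C P Q)
  | H : dec (ext ?C) (fun p => ?Q (fst p) (snd p)) |- dec ?D (fun i => ?Q (@?h i) (@?x i)) =>
      refine (comp_sub (ext C) D (fun i => (h i, x i)) _ (fun _ => eq_refl) _ H);
      cbn [inp ext fst snd]
  | |- _ => first [comp_known_set | comp_known_eval | comp_known_stage | comp_leaf]
  end.

Ltac comp_auto := repeat comp_step.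

(** * Finite sets as numbers *)
Fixpoint nest (P : nat -> Prop) (n : nat) : nat :=
  match n with 0 => 0 | S k => pair_nat (chi (P k)) (nest P k) end.

(** The length is kept because the last value comes first in the nested pairs. *)
Definition bits (P : nat -> Prop) (n : nat) : nat := pair_nat n (nest P n).

Definition mem (b x : nat) : Prop :=
  x < pfst b /\ pfst (Nat.iter (pfst b - S x) psnd (psnd b)) = 1.

Lemma iter_nest P j m : Nat.iter j psnd (nest P (j + m)) = nest P m.
Proof.
  revert m; induction j as [|j IH]; intros m; [reflexivity|].
  change (psnd (Nat.iter j psnd (nest P (S j + m))) = nest P m).
  rewrite Nat.add_succ_comm, IH; cbn [nest]; apply psnd_pair.
Qed.

Lemma mem_bits P n x : mem (bits P n) x <-> x < n /\ P x.
Proof.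
  unfold mem, bits; rewrite pfst_pair, psnd_pair.
  split; intros [H H']; split; auto; revert H';
    replace n with ((n - S x) + S x) at 2 by lia; rewrite iter_nest; cbn [nest];
    rewrite pfst_pair; apply chi_1.
Qed.

Lemma comp_bits C n (P : idx C -> nat -> Prop) :
  dec (ext C) (fun p => P (fst p) (snd p)) -> comp C n ->
  comp C (fun i => bits (P i) (n i)).
Proof.
  intros HP Hn; apply comp_pair; auto.
  apply (comp_rec_at C (fun i n => nest (P i) n)); auto; [exact (comp_const C 0)|].
  cbn [nest]; comp_auto.
Qed.

Lemma dec_mem C b x : comp C b -> comp C x -> dec C (fun i => mem (b i) (x i)).
Proof.
  intros; apply (dec_and C (fun i => x i < pfst (b i))); [comp_auto|].
  apply dec_eq; [|apply comp_const]; apply comp_pfst, comp_iter_psnd; comp_auto.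
Qed.

Ltac comp_known_set ::=
  match goal with
  | |- dec ?C (fun i => mem (@?b i) (@?x i)) => apply (dec_mem C b x)
  end.

(** A relation given by stages, each a finite set obtained from the previous
    one by a computable rule, is computable: a stage is coded by a number. *)
Lemma dec_table C (T : idx C -> nat -> nat -> Prop)
    (R : idx C -> (nat -> Prop) -> nat -> nat -> Prop) :
  (forall i w, ~ T i 0 w) ->
  (forall i d w, T i (S d) w <-> w < S d /\ R i (T i d) d w) ->
  (forall f : idx C -> nat -> nat,
      dec (ext (ext_val C f)) (fun p =>
        R (fst (fst p)) (mem (f (fst (fst p)) (snd (fst p)))) (snd (fst p)) (snd p))) ->
  forall d w, comp C d -> comp C w -> dec C (fun i => T i (d i) (w i)).
Proof.
  intros H0 HS HR d w Hd Hw.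
  set (f := fun i n => bits (T i n) n).
  assert (E : forall i n, mem (f i n) = T i n).
  { intros i n; extensionality x; apply propositional_extensionality.
    unfold f; rewrite mem_bits; split; [tauto|]; intros HT; split; auto.
    destruct n; [destruct (H0 _ _ HT)|now apply HS in HT]. }
  apply (dec_iff C (fun i => mem (f i (d i)) (w i))).
  { intros i; now rewrite E. }
  apply dec_mem; auto.
  apply (comp_rec_at C f); auto; [exact (comp_const C (pair_nat 0 0))|].
  apply (comp_eq (ext_val C f) (fun p => bits (fun w =>
    R (fst p) (mem (f (fst p) (snd p))) (snd p) w) (S (snd p)))).
  { intros [i n]; cbn [fst snd]; rewrite E; unfold f, bits; f_equal; f_equal.
    enough (forall m, m <= S n -> nest (R i (T i n) n) m = nest (T i (S n)) m) by auto.
    induction m; cbn [nest]; auto; intros; rewrite IHm by lia; f_equal; f_equal.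
    apply chi_iff; rewrite HS; intuition lia. }
  apply comp_bits; [apply HR|comp_auto].
Qed.

(** * A bounded universal evaluator *)
Definition isprog (e : nat) : Prop := exists c, encode c = e.

(** The numbers that code a program, recognized from their parts.  This is
    asked separately because a recursion of length [0] halts without running
    its step, although a number whose step is no program is no index. *)
Definition prog_rule (T : nat -> Prop) (e : nat) : Prop :=
  (pfst e < 5 /\ psnd e = 0) \/
  (4 < pfst e /\ pfst e < 8 /\ T (pfst (psnd e)) /\ T (psnd (psnd e))) \/
  (pfst e = 8 /\ T (psnd e)).

Fixpoint prog (d : nat) : nat -> Prop :=
  match d with
  | 0 => fun _ => False
  | S k => fun e => e < S k /\ prog_rule (prog k) e
  end.

Lemma prog_sound d e : prog d e -> isprog e.
Proof.
  revert e; induction d as [|d IH]; cbn [prog]; [tauto|].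
  intros e [_ [[H1 H2]|[(H1 & H2 & H3 & H4)|[H1 H2]]]];
    rewrite <- (pair_surj e).
  - rewrite H2; destruct (pfst e) as [|[|[|[|[|]]]]]; try lia;
      [exists Zero|exists Succ|exists Fst|exists Snd|exists Oracle]; reflexivity.
  - apply IH in H3, H4; destruct H3 as [f H3], H4 as [g H4].
    rewrite <- (pair_surj (psnd e)), <- H3, <- H4.
    destruct (pfst e) as [|[|[|[|[|[|[|[|]]]]]]]]; try lia;
      [exists (Pair f g)|exists (Comp f g)|exists (Prec f g)]; reflexivity.
  - apply IH in H2; destruct H2 as [f H2]; rewrite H1, <- H2; now exists (Mu f).
Qed.

Lemma prog_complete d c : encode c < d -> prog d (encode c).
Proof.
  revert d; induction c; intros d Hd; (destruct d as [|d]; [lia|]); split; auto;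
    unfold prog_rule; cbn [encode] in *; rewrite ?pfst_pair, ?psnd_pair, ?pfst_pair;
    rewrite ?pfst_pair, ?psnd_pair;
    try (left; split; lia);
    right; [left|left|left|right]; repeat split; try lia;
    (apply IHc || apply IHc1 || apply IHc2);
    match type of Hd with pair_nat ?t ?l < _ => pose proof (pair_le_sum t l) end;
    try (pose proof (pair_le_sum (encode c1) (encode c2))); lia.
Qed.

Lemma dec_isprog C e : comp C e -> dec C (fun i => isprog (e i)).
Proof.
  intros He; apply (dec_iff C (fun i => prog (S (e i)) (e i))).
  { intros i; split; [apply prog_sound|]; intros [c <-]; apply prog_complete; auto. }
  apply (dec_table C (fun _ => prog) (fun _ T _ => prog_rule T)); [now cbn..| |comp_auto|auto].
  intros f; unfold prog_rule; comp_auto.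
Qed.

Definition fact (e x y : nat) : nat := pair_nat e (pair_nat x y).

(** One step of derivation: [T] is the set of evaluations known so far, and [d]
    bounds the oracle queries and the intermediate values. *)
Definition eval_rule (O T : nat -> Prop) (d w : nat) : Prop :=
  let e := pfst w in let x := pfst (psnd w) in let y := psnd (psnd w) in
  let t := pfst e in let l := psnd e in let f := pfst l in let g := psnd l in
  (t = 0 /\ l = 0 /\ y = 0) \/
  (t = 1 /\ l = 0 /\ y = S x) \/
  (t = 2 /\ l = 0 /\ y = pfst x) \/
  (t = 3 /\ l = 0 /\ y = psnd x) \/
  (t = 4 /\ l = 0 /\ x < d /\ y = chi (O x)) \/
  (t = 5 /\ T (fact f x (pfst y)) /\ T (fact g x (psnd y))) \/
  (t = 6 /\ exists u, u < d /\ (T (fact g x u) /\ T (fact f u y))) \/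
  (t = 7 /\ psnd x = 0 /\ isprog g /\ T (fact f (pfst x) y)) \/
  (t = 7 /\ 0 < psnd x /\ exists r, r < d /\
     (T (fact e (pair_nat (pfst x) (pred (psnd x))) r) /\
      T (fact g (pair_nat (pfst x) (pair_nat (pred (psnd x)) r)) y))) \/
  (t = 8 /\ T (fact l (pair_nat x y) 0) /\
     forall z, z < y -> exists v, v < d /\ T (fact l (pair_nat x z) (S v))).

Fixpoint facts (O : nat -> Prop) (d : nat) : nat -> Prop :=
  match d with
  | 0 => fun _ => False
  | S k => fun w => w < S k /\ eval_rule O (facts O k) k w
  end.

Definition ev (O : nat -> Prop) (d e x y : nat) : Prop := facts O d (fact e x y).

Lemma dec_ev C (O : idx C -> nat -> Prop) d e x y :
  dec (ext C) (fun p => O (fst p) (snd p)) ->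
  comp C d -> comp C e -> comp C x -> comp C y ->
  dec C (fun i => ev (O i) (d i) (e i) (x i) (y i)).
Proof.
  intros HO; intros; apply (dec_table C (fun i => facts (O i)) (fun i => eval_rule (O i)));
    [now cbn..| |auto|unfold fact; comp_auto].
  intros f; unfold eval_rule, fact; cbv zeta.
  comp_auto; try apply dec_isprog; comp_auto.
Qed.

Lemma fact_parts e x y :
  pfst (fact e x y) = e /\ pfst (psnd (fact e x y)) = x /\ psnd (psnd (fact e x y)) = y.
Proof. unfold fact; now rewrite ?psnd_pair, ?pfst_pair, ?psnd_pair. Qed.

Lemma fact_surj w : fact (pfst w) (pfst (psnd w)) (psnd (psnd w)) = w.
Proof. unfold fact; now rewrite !pair_surj. Qed.

(** For a recursion of positive length, the known shorter recursion already
    certifies that the whole number is a program; its step is the one run here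
    as codes are unique. *)
Lemma facts_sound O d w :
  facts O d w -> Phi (pfst w) O (pfst (psnd w)) (psnd (psnd w)).
Proof.
  revert w; induction d as [|d IH]; [easy|].
  assert (IH' : forall e x y, facts O d (fact e x y) -> Phi e O x y).
  { intros e x y H; apply IH in H; destruct (fact_parts e x y) as (E1 & E2 & E3).
    now rewrite E1, E2, E3 in H. }
  clear IH; intros w [_ H]; revert H; unfold eval_rule; cbv zeta.
  set (x := pfst (psnd w)); set (y := psnd (psnd w)).
  generalize (pfst w); intros e.
  pose proof (pair_surj e) as Ee; revert Ee.
  generalize (pfst e) as t, (psnd e) as l; intros t l Ee; revert Ee.
  rewrite <- (pair_surj l) at 1; intros Ee.
  intros [(-> & -> & Hy)|[(-> & -> & Hy)|[(-> & -> & Hy)|[(-> & -> & Hy)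
    |[(-> & -> & _ & Hy)|[(-> & Hf & Hg)|[(-> & u & _ & Hg & Hf)|[(-> & Hx & [g Hg] & Hf)
    |[(Ht & Hx & r & _ & Hr & Hg)|(-> & Hf & Hz)]]]]]]]]].
  1-4: rewrite pair_surj in Ee.
  - exists Zero; split; auto.
  - exists Succ; split; auto.
  - exists Fst; split; auto.
  - exists Snd; split; auto.
  - exists Oracle; split; [now rewrite pair_surj in Ee|].
    rewrite Hy; cbn [eval]; unfold chi; destruct excluded_middle_informative; tauto.
  - apply IH' in Hf, Hg; destruct Hf as (f & Ef & Hf), Hg as (g & Eg & Hg).
    exists (Pair f g); split; [cbn [encode]; now rewrite Ef, Eg|].
    cbn [eval]; exists (pfst y), (psnd y); now rewrite pair_surj.
  - apply IH' in Hf, Hg; destruct Hf as (f & Ef & Hf), Hg as (g & Eg & Hg).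
    exists (Comp f g); split; [cbn [encode]; now rewrite Ef, Eg|].
    cbn [eval]; eauto.
  - apply IH' in Hf; destruct Hf as (f & Ef & Hf).
    exists (Prec f g); split; [cbn [encode]; now rewrite Ef, Hg|].
    cbn; change (snd (Cantor.of_nat x)) with (psnd x); rewrite Hx; exact Hf.
  - apply IH' in Hr, Hg; destruct Hr as (c & Ec & Hr), Hg as (g & Eg & Hg).
    assert (exists f g', c = Prec f g' /\ encode g' = psnd l) as (f & g' & -> & Eg').
    { revert Ec; rewrite <- Ee, Ht.
      destruct c; cbn [encode]; intros E; apply Cantor.to_nat_inj in E; try discriminate E.
      apply (f_equal snd) in E; cbn [snd] in E; apply Cantor.to_nat_inj in E.
      do 2 eexists; split; [reflexivity|].
      exact (f_equal snd E). }
    assert (g' = g) as -> by (apply encode_inj; congruence).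
    exists (Prec f g); split; [exact Ec|].
    cbn in Hr |- *; rewrite Cantor.cancel_of_to in Hr; cbn [fst snd] in Hr.
    change (snd (Cantor.of_nat x)) with (psnd x).
    destruct (psnd x) as [|n]; [lia|]; exists r; split; [exact Hr|exact Hg].
  - rewrite pair_surj in Ee; apply IH' in Hf; destruct Hf as (f & Ef & Hf).
    exists (Mu f); split; [cbn [encode]; now rewrite Ef|].
    cbn [eval]; split; [exact Hf|]; intros z Hzy.
    destruct (Hz z Hzy) as (v & _ & Hv); apply IH' in Hv; destruct Hv as (f' & Ef' & Hv).
    assert (f' = f) as -> by (apply encode_inj; congruence); eauto.
Qed.

Lemma eval_rule_mono O (T T' : nat -> Prop) d d' w :
  d <= d' -> (forall v, T v -> T' v) -> eval_rule O T d w -> eval_rule O T' d' w.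
Proof.
  intros Hd HT; unfold eval_rule; cbv zeta.
  intros [H|[H|[H|[H|[(H1 & H2 & H3 & H4)|[(H1 & H2 & H3)|[(H1 & u & H2 & H3 & H4)|[(H1 & H2 & H3 & H4)
    |[(H1 & H2 & r & H3 & H4 & H5)|(H1 & H2 & H3)]]]]]]]]].
  1-4: tauto.
  - do 4 right; left; repeat split; auto; lia.
  - do 5 right; left; auto.
  - do 6 right; left; split; auto; exists u; repeat split; auto; lia.
  - do 7 right; left; auto.
  - do 8 right; left; repeat split; auto; exists r; repeat split; auto; lia.
  - do 9 right; repeat split; auto; intros z Hz; destruct (H3 z Hz) as (v & Hv & Hv').
    exists v; split; auto; lia.
Qed.

Lemma facts_bound O d w : facts O d w -> w < d.
Proof. destruct d; cbn [facts]; tauto. Qed.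

Lemma facts_step O d w : facts O d w -> facts O (S d) w.
Proof.
  revert w; induction d as [|d IH]; intros w; [easy|].
  intros [Hw H]; split; [lia|]; revert H; apply eval_rule_mono; auto.
Qed.

Lemma ev_mono O d d' e x y : d <= d' -> ev O d e x y -> ev O d' e x y.
Proof. unfold ev; induction 1; auto using facts_step. Qed.

Lemma ev_bound O d e x y : ev O d e x y -> y < d.
Proof.
  intros H; apply facts_bound in H; revert H; unfold fact.
  pose proof (pair_le_sum e (pair_nat x y)); pose proof (pair_le_sum x y); lia.
Qed.

Lemma ev_sound O d e x y : ev O d e x y -> Phi e O x y.
Proof.
  intros H; apply facts_sound in H; destruct (fact_parts e x y) as (E1 & E2 & E3).
  now rewrite E1, E2, E3 in H.
Qed.

Lemma ev_rule O d e x y : eval_rule O (facts O d) d (fact e x y) -> exists d', ev O d' e x y.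
Proof.
  intros H; exists (S (max d (fact e x y))); split; [lia|].
  revert H; apply eval_rule_mono; [lia|].
  intros v Hv; rewrite <- (fact_surj v) in *.
  revert Hv; apply ev_mono; lia.
Qed.

Ltac by_mono :=
  match goal with
  | H : ev ?O ?d ?e ?x ?y |- facts ?O ?d' (fact ?e ?x ?y) => apply (ev_mono O d d'); [lia|exact H]
  | H : ev ?O ?d ?e ?x ?y |- ev ?O ?d' ?e ?x ?y => apply (ev_mono O d d'); [lia|exact H]
  end.

(** The bounds of the subcomputations have a maximum; for [Mu] this uses that
    only finitely many values are met before the search stops. *)
Lemma ev_complete O c x y : eval O c x y -> exists d, ev O d (encode c) x y.
Proof.
  revert x y; induction c; cbn [eval encode]; intros x y H.
  - apply (ev_rule O 0); unfold eval_rule; cbv zeta.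
    destruct (fact_parts (pair_nat 0 0) x y) as (-> & -> & ->); rewrite pfst_pair, psnd_pair; auto.
  - apply (ev_rule O 0); unfold eval_rule; cbv zeta.
    destruct (fact_parts (pair_nat 1 0) x y) as (-> & -> & ->); rewrite pfst_pair, psnd_pair; auto.
  - apply (ev_rule O 0); unfold eval_rule; cbv zeta.
    destruct (fact_parts (pair_nat 2 0) x y) as (-> & -> & ->); rewrite pfst_pair, psnd_pair; auto 10.
  - apply (ev_rule O 0); unfold eval_rule; cbv zeta.
    destruct (fact_parts (pair_nat 3 0) x y) as (-> & -> & ->); rewrite pfst_pair, psnd_pair; auto 10.
  - apply (ev_rule O (S x)); unfold eval_rule; cbv zeta.
    destruct (fact_parts (pair_nat 4 0) x y) as (-> & -> & ->); rewrite pfst_pair, psnd_pair.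
    do 4 right; left; repeat split; auto. unfold chi; destruct excluded_middle_informative; tauto.
  - destruct H as (u & v & Hu & Hv & ->).
    destruct (IHc1 _ _ Hu) as [d1 H1], (IHc2 _ _ Hv) as [d2 H2].
    apply (ev_rule O (max d1 d2)); unfold eval_rule; cbv zeta.
    edestruct fact_parts as (-> & -> & ->); rewrite !pfst_pair, !psnd_pair, !pfst_pair.
    do 5 right; left; repeat split; by_mono.
  - destruct H as (u & Hu & Hv).
    destruct (IHc1 _ _ Hv) as [d1 H1], (IHc2 _ _ Hu) as [d2 H2].
    apply (ev_rule O (max d1 d2)); unfold eval_rule; cbv zeta.
    edestruct fact_parts as (-> & -> & ->); rewrite !pfst_pair, !psnd_pair, !pfst_pair.
    do 6 right; left; repeat split; exists u; repeat split; [|by_mono..].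
    apply ev_bound in H2; lia.
  - assert (forall a n y, prec_graph (eval O c1 a)
      (fun k r => eval O c2 (pair_nat a (pair_nat k r))) n y ->
      exists d, ev O d (pair_nat 7 (pair_nat (encode c1) (encode c2))) (pair_nat a n) y) as P;
      [|rewrite <- (pair_surj x); apply P, H].
    clear x y H.
    intros a n; induction n as [|n IH]; cbn [prec_graph]; intros y H.
    + destruct (IHc1 _ _ H) as [d1 H1].
      apply (ev_rule O d1); unfold eval_rule; cbv zeta.
      edestruct fact_parts as (-> & -> & ->); rewrite !pfst_pair, !psnd_pair, !pfst_pair.
      do 7 right; left; repeat split; auto; eexists; reflexivity.
    + destruct H as (r & Hr & H).
      destruct (IH _ Hr) as [d1 H1], (IHc2 _ _ H) as [d2 H2].
      apply (ev_rule O (max d1 d2)); unfold eval_rule; cbv zeta.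
      edestruct fact_parts as (-> & -> & ->); rewrite !pfst_pair, !psnd_pair.
      do 8 right; left; repeat split; [lia|]; exists r; cbn [pred].
      repeat split; [|by_mono..].
      apply ev_bound in H1; lia.
  - destruct H as [H L]; destruct (IHc _ _ H) as [d0 H0].
    assert (forall y', y' <= y -> exists d, forall z, z < y' -> exists v,
      v < d /\ ev O d (encode c) (pair_nat x z) (S v)) as HL.
    { induction y' as [|y' IH]; intros Hy; [exists 0; lia|].
      destruct IH as [d1 H1]; [lia|]; destruct (L y' Hy) as [v Hv].
      destruct (IHc _ _ Hv) as [d2 H2]; exists (max d1 d2); intros z Hz.
      destruct (Nat.eq_dec z y') as [->|].
      - exists v; split; [apply ev_bound in H2; lia|by_mono].
      - destruct (H1 z) as (v' & Hv' & Hz'); [lia|].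
        exists v'; split; [lia|by_mono]. }
    destruct (HL y (le_n _)) as [d1 H1].
    apply (ev_rule O (max d0 d1)); unfold eval_rule; cbv zeta.
    edestruct fact_parts as (-> & -> & ->); rewrite !pfst_pair, !psnd_pair.
    do 9 right; repeat split; [by_mono|].
    intros z Hz; destruct (H1 z Hz) as (v' & Hv' & Hz'); exists v'; split; [lia|].
    by_mono.
Qed.

Lemma Phi_ev O e x y : Phi e O x y <-> exists d, ev O d e x y.
Proof.
  split; [|intros [d H]; now apply ev_sound in H].
  intros (c & <- & H); now apply ev_complete.
Qed.

(** The evaluation with bound [d] queries its oracle below [d] only, so the
    bound also serves as a use. *)
Lemma ev_local O O' d e x y :
  (forall q, q < d -> O q <-> O' q) -> ev O d e x y <-> ev O' d e x y.
Proof.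
  unfold ev; generalize (fact e x y); induction d as [|d IH]; intros w H; [easy|].
  cbn [facts]; apply and_iff_compat_l.
  replace (facts O' d) with (facts O d).
  - unfold eval_rule; cbv zeta.
    enough (forall q, q < d -> chi (O q) = chi (O' q)) as E.
    { split; intros [H1|[H1|[H1|[H1|[(H1 & H2 & H3 & H4)|H1]]]]];
      (tauto || (do 4 right; left; rewrite ?E, <- ?E in * by auto; auto)). }
    intros; apply chi_iff, H; lia.
  - extensionality v; apply propositional_extensionality, IH; intros; apply H; lia.
Qed.

Definition conv (O : nat -> Prop) (d e x : nat) : Prop := exists y, y < d /\ ev O d e x y.

Lemma conv_mono O d d' e x : d <= d' -> conv O d e x -> conv O d' e x.
Proof. intros Hd (y & Hy & H); exists y; split; [lia|]; revert H; now apply ev_mono. Qed.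

Lemma conv_local O O' d e x :
  (forall q, q < d -> O q <-> O' q) -> conv O d e x <-> conv O' d e x.
Proof.
  intros H; split; intros (y & Hy & H'); exists y; split; auto; 
    revert H'; apply ev_local; firstorder.
Qed.

Lemma conv_Phi O e x : (exists d, conv O d e x) <-> exists y, Phi e O x y.
Proof.
  split.
  - intros (d & y & _ & H); exists y; now apply ev_sound in H.
  - intros [y H]; apply Phi_ev in H; destruct H as [d H].
    exists d, y; split; auto; now apply ev_bound in H.
Qed.

Lemma conv_jump O q : (exists d, conv O d q q) <-> jump O q.
Proof. apply conv_Phi. Qed.

Lemma dec_conv C (O : idx C -> nat -> Prop) d e x :
  dec (ext C) (fun p => O (fst p) (snd p)) ->
  comp C d -> comp C e -> comp C x ->
  dec C (fun i => conv (O i) (d i) (e i) (x i)).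
Proof.
  intros HO; intros; unfold conv; comp_auto.
  apply (dec_ev (ext C) (fun p => O (fst p))); comp_auto.
Qed.

Ltac comp_known_eval ::=
  match goal with
  | |- dec ?C (fun i => ev (@?O i) (@?d i) (@?e i) (@?x i) (@?y i)) =>
      apply (dec_ev C O d e x y)
  | |- dec ?C (fun i => conv (@?O i) (@?d i) (@?e i) (@?x i)) =>
      apply (dec_conv C O d e x)
  end.

(** * Indices, relativization and jumps *)

Definition with_orc (C : ctx) (O : idx C -> nat -> Prop) : ctx := Ctx (idx C) O (inp C).

Definition jctx (C : ctx) : ctx := with_orc C (fun i => jump (orc C i)).

(** The universal machine: the index, the oracle and the argument may all depend
    on the context. *)
Lemma comp_Phi C (O : idx C -> nat -> Prop) n x f :
  dec (ext C) (fun p => O (fst p) (snd p)) -> comp C n -> comp C x ->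
  (forall i, Phi (n i) (O i) (x i) (f i)) -> comp C f.
Proof.
  intros HO Hn Hx Hf.
  apply (comp_eq C (fun i => psnd (least (fun w => ev (O i) (pfst w) (n i) (x i) (psnd w))))).
  - intros i; destruct (proj1 (Phi_ev _ _ _ _) (Hf i)) as [d Hd].
    eapply Phi_functional; [|apply Hf]; eapply ev_sound.
    apply (least_spec (fun w => ev (O i) (pfst w) (n i) (x i) (psnd w)) (pair_nat d (f i))).
    now rewrite pfst_pair, psnd_pair.
  - apply comp_psnd, (comp_least C (fun i w => ev (O i) (pfst w) (n i) (x i) (psnd w))).
    + comp_auto.
    + intros i; destruct (proj1 (Phi_ev _ _ _ _) (Hf i)) as [d Hd].
      exists (pair_nat d (f i)); now rewrite pfst_pair, psnd_pair.
Qed.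

(** Computations can be transferred to a context whose oracle computes the old
    one uniformly. *)
Lemma comp_trans C (O' : idx C -> nat -> Prop) (inp' : idx C -> nat) f :
  dec (ext (Ctx (idx C) O' inp')) (fun p => orc C (fst p) (snd p)) ->
  comp (Ctx (idx C) O' inp') (inp C) -> comp C f -> comp (Ctx (idx C) O' inp') f.
Proof.
  intros HO Hi [c Hc].
  apply (comp_Phi (Ctx (idx C) O' inp') (orc C) (fun _ => encode c) (inp C)); auto.
  - apply (comp_const (Ctx (idx C) O' inp')).
  - intros i; exists c; auto.
Qed.

Lemma dec_sd C P : dec C P -> sd C P.
Proof.
  intros H.
  destruct (sd_ex C (fun i _ => P i)) as [c Hc].
  - apply (comp_ext C (fun p => chi (P (fst p)))); auto.
  - exists c; intros i; rewrite <- Hc; split; [exists 0|intros [_ ?]]; auto.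
Qed.

Lemma sd_iff C P Q : (forall i, P i <-> Q i) -> sd C P -> sd C Q.
Proof. intros E [c H]; exists c; intros i; rewrite <- E; apply H. Qed.

(** A program that ignores its argument and starts from the constant [inp i] has
    an index computable from the input, so the question becomes a single query
    to the jump. *)
Lemma dec_jump_sd C P : sd C P -> dec (jctx C) P.
Proof.
  intros [v Hv].
  apply (dec_iff (jctx C)
    (fun i => orc (jctx C) i (encode (Comp v (const_code (inp C i)))))).
  - intros i; rewrite Hv; cbn [jctx with_orc orc idx]; unfold jump; split.
    + intros (y & c & E & H); apply encode_inj in E; subst c; cbn [eval] in H.
      destruct H as (u & Hu & H); exists y.
      now rewrite (eval_functional _ _ _ _ _ Hu (eval_const _ _ _)) in H.
    + intros [y H]; exists y; eexists; split; [reflexivity|]; cbn.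
      exists (inp C i); split; auto using eval_const.
  - apply dec_orc; cbn [encode].
    do 2 (apply comp_pair; [exact (comp_const (jctx C) _)|]).
    apply comp_encode_const, (comp_inp (jctx C)).
Qed.

Lemma dec_jump_dec C P : dec C P -> dec (jctx C) P.
Proof. intros; now apply dec_jump_sd, dec_sd. Qed.

Lemma comp_jump C f : comp C f -> comp (jctx C) f.
Proof.
  intros H; apply (comp_eq (jctx C) (fun i => least (fun n => f i = n))).
  - intros i; symmetry; now apply (least_spec (fun n => f i = n) (f i)).
  - apply comp_least; [|eauto].
    assert (D : dec (ext C) (fun p => f (fst p) = snd p)) by comp_auto.
    exact (dec_jump_dec (ext C) _ D).
Qed.

Lemma jump_conv O q : jump O q <-> exists d, conv O d q q.
Proof. symmetry; apply conv_jump. Qed.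

Lemma sd_jump_of C (O : idx C -> nat -> Prop) q :
  dec (ext C) (fun p => O (fst p) (snd p)) -> comp C q ->
  sd C (fun i => jump (O i) (q i)).
Proof.
  intros HO Hq.
  apply (sd_iff C (fun i => exists d, conv (O i) d (q i) (q i))).
  { intros i; symmetry; apply jump_conv. }
  apply (sd_ex C (fun i d => conv (O i) d (q i) (q i))); comp_auto.
Qed.

Definition any : ctx := Ctx ((nat -> Prop) * nat) fst snd.

(** The usual self-application; the program has access to its own code as a
    number. *)
Lemma recursion_theorem F :
  exists c, forall X x y, eval X c x y <-> eval X F (pair_nat (encode c) x) y.
Proof.
  set (id := Pair Fst Snd).
  assert (Hid : forall X x y, eval X id x y <-> y = x).
  { intros; cbn; split.
    - intros (u & v & -> & -> & ->); apply pair_surj.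
    - intros ->; do 2 eexists; repeat split; symmetry; apply pair_surj. }
  assert (exists h, forall X n, eval X h n
    (pair_nat 6 (pair_nat n (pair_nat 5 (pair_nat (encode (const_code n)) (encode id))))))
    as [h Hh].
  { enough (comp any (fun i => pair_nat 6 (pair_nat (inp any i)
      (pair_nat 5 (pair_nat (encode (const_code (inp any i))) (encode id)))))) as [h H].
    - exists h; intros X n; apply (H (X, n)).
    - comp_auto. }
  (* [h] sends [n] to the code of program number [n] with its first argument
     fixed to [n], and the fixed point is the case [n = encode G]. *)
  set (G := Comp F (Pair (Comp h Fst) Snd)).
  exists (Comp G (Pair (const_code (encode G)) id)); intros X x y.
  set (e := encode (Comp G (Pair (const_code (encode G)) id))).
  assert (Hu : forall u, eval X (Pair (const_code (encode G)) id) x u <->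
    u = pair_nat (encode G) x).
  { intros u; split.
    - intros (a & b & Ha & Hb & ->); apply Hid in Hb; subst b.
      now rewrite (eval_functional _ _ _ _ _ Ha (eval_const _ _ _)).
    - intros ->; do 2 eexists; repeat split; [apply eval_const|now apply Hid]. }
  assert (Hw : forall w, eval X (Pair (Comp h Fst) Snd) (pair_nat (encode G) x) w <->
    w = pair_nat e x).
  { intros w; split.
    - intros (a & b & (n & Hn & Ha) & Hb & ->); cbn in Hn, Hb; subst n b.
      rewrite !Cantor.cancel_of_to in *; cbn [fst snd] in *.
      now rewrite (eval_functional _ _ _ _ _ Ha (Hh _ _)).
    - intros ->; exists e, x; repeat split.
      + exists (encode G); split; [cbn; now rewrite Cantor.cancel_of_to|apply Hh].
      + cbn; now rewrite Cantor.cancel_of_to. }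
  change (eval X (Comp G (Pair (const_code (encode G)) id)) x y) with
    (exists u, eval X (Pair (const_code (encode G)) id) x u /\
      exists w, eval X (Pair (Comp h Fst) Snd) u w /\ eval X F w y).
  split.
  - intros (u & H1 & w & H2 & H3); apply Hu in H1; subst u; apply Hw in H2; now subst w.
  - intros H; eexists; split; [now apply Hu|]; eexists; split; [now apply Hw|exact H].
Qed.

Definition good_index (P Q : nat -> nat -> Prop) (n m : nat) : Prop :=
  forall x, Phi n (Q m) x (chi (P m x)).

(** The inductive step of a uniform reduction: an index that is good at level
    [m] is given, and level [m + 1] is to be computed. *)
Definition step_ctx (P Q : nat -> nat -> Prop) : ctx :=
  Ctx { t : nat * nat * nat | good_index P Q (fst (fst t)) (snd (fst t)) }
    (fun t => Q (S (snd (fst (proj1_sig t)))))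
    (fun t => pair_nat (pair_nat (fst (fst (proj1_sig t))) (snd (fst (proj1_sig t))))
                (snd (proj1_sig t))).

Definition level_ctx (Q : nat -> nat -> Prop) : ctx :=
  Ctx (nat * nat) (fun p => Q (fst p)) (fun p => pair_nat (fst p) (snd p)).

(** Reductions at all levels that are obtained by recursion on the level are
    uniform, since each index is computed from the preceding one. *)
Lemma uniform_iteration (P Q : nat -> nat -> Prop) :
  dec (Ctx nat (fun _ => Q 0) (fun x => x)) (P 0) ->
  dec (step_ctx P Q) (fun t => P (S (snd (fst (proj1_sig t)))) (snd (proj1_sig t))) ->
  dec (level_ctx Q) (fun p => P (fst p) (snd p)).
Proof.
  intros [b Hb] [v Hv].
  set (index := fix index m := match m with
    | 0 => encode b
    | S k => encode (Comp v (Pair (const_code (pair_nat (index k) k)) (Pair Fst Snd)))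
    end).
  assert (HG : forall m, good_index P Q (index m) m).
  { induction m as [|m IH]; intros x; cbn [index].
    - exists b; split; [reflexivity|apply Hb].
    - eexists; split; [reflexivity|].
      specialize (Hv (exist _ (index m, m, x) IH)); cbn in Hv |- *.
      eexists; split; [|exact Hv]; do 2 eexists; split; [apply eval_const|].
      split; [|reflexivity]; do 2 eexists; repeat split; symmetry; apply pair_surj. }
  assert (HI : comp (level_ctx Q) (fun p => index (fst p))).
  { apply (comp_rec_at (level_ctx Q) (fun _ => index)); [apply comp_const| |].
    - cbn [index encode].
      apply (comp_eq (ext_val (level_ctx Q) (fun _ => index)) (fun p =>
        pair_nat 6 (pair_nat (encode v) (pair_nat 5 (pair_nat (encode (const_code
          (pair_nat (index (snd p)) (snd p)))) (encode (Pair Fst Snd))))))); [reflexivity|].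
      assert (comp (ext_val (level_ctx Q) (fun _ => index)) (fun p => index (snd p)))
        by apply (comp_val (level_ctx Q) (fun _ => index)).
      comp_auto.
    - apply (comp_eq (level_ctx Q) (fun p => pfst (inp (level_ctx Q) p)));
        [intros p; apply pfst_pair|comp_auto]. }
  apply (comp_Phi (level_ctx Q) (orc (level_ctx Q)) (fun p => index (fst p)) snd); auto.
  - apply (dec_orc (ext (level_ctx Q))), comp_var.
  - apply (comp_eq (level_ctx Q) (fun p => psnd (inp (level_ctx Q) p)));
      [intros p; apply psnd_pair|comp_auto].
  - intros [m x]; apply HG.
Qed.

(** * One level: enumeration with restraint *)

(** The number asked about is at most the query, so a use for the join is also
    one for [A]. *)
Definition join (A X : nat -> Prop) (q : nat) : Prop :=
  (pfst q = 0 /\ A (psnd q)) \/ (0 < pfst q /\ X (psnd q)).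

Lemma join_local A A' X u :
  (forall x, x < u -> A x <-> A' x) -> forall q, q < u -> join A X q <-> join A' X q.
Proof.
  intros H q Hq; unfold join; pose proof (psnd_le q); rewrite (H (psnd q)) by lia; tauto.
Qed.

Lemma finite_collection (P : nat -> nat -> Prop) n :
  (forall k t t', t <= t' -> P k t -> P k t') ->
  (forall k, k < n -> exists t, P k t) -> exists t, forall k, k < n -> P k t.
Proof.
  intros HM; induction n as [|n IH]; intros H; [exists 0; lia|].
  destruct IH as [t Ht]; [auto|]; destruct (H n) as [t' Ht']; auto.
  exists (max t t'); intros k Hk; destruct (Nat.eq_dec k n) as [->|].
  - apply (HM n t'); auto; lia.
  - apply (HM k t); [lia|]; apply Ht; lia.
Qed.

(** The set built from the oracle [X] at level [m]; [p] is the index through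
    which the next level is known. *)
Section Construction.

Variables (X : nat -> Prop) (p m : nat).

(** The jump of [X] as it appears at stage [t]. *)
Definition approx (t q : nat) : Prop := conv X t q q.

(** The pair [w = <s, t0>] claims that [p] halts on [<m+1, z>] within bound [s],
    and that the jump of [X] has settled below [s] at stage [t0].  The claim is
    refuted at stage [t] if the computation is missing or if the jump has since
    changed; all pairs are refuted exactly if [z] is not in the next set. *)
Definition refuted (z w t : nat) : Prop :=
  ~ conv (approx (psnd w)) (pfst w) p (pair_nat (S m) z) \/
  exists q, q < pfst w /\ (approx t q /\ ~ approx (psnd w) q).

(** Column [0] holds the special bit in its element [0].  In column [z + 1] a
    number becomes a target when all claims up to it are refuted, so the targets
    of a column form an initial segment of it. *)
Definition target (s x : nat) : Prop :=
  (x = 0 /\ ev X s m m 0) \/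
  (0 < pfst x /\ forall w, w < S (psnd x) -> exists t, t < s /\ refuted (pred (pfst x)) w t).

(** Requirement [e] with oracle [O], seen with use at most [u].  Requirement [0]
    is the special question of level [m]. *)
Definition req (e : nat) (O : nat -> Prop) (u : nat) : Prop :=
  (e = 0 /\ ev O u m m 0) \/ (0 < e /\ conv O u (pred e) (pred e)).

(** The restraint: [l] is the number enumerated last.  Requirement [e] is heard
    if it holds with use at most [l], and then protects the numbers of higher
    columns that lie below its use, which are those with which it does not yet
    hold. *)
Definition eligible (A : nat -> Prop) (l s x : nat) : Prop :=
  ~ A x /\ target s x /\
  forall e, e < pfst x -> req e (join A X) l -> req e (join A X) x.

(** At most one number, and the least possible one, is enumerated at each stage;
    the value [s] stands for none, and then every use up to [s] passes the test
    of the next stage. *)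
Definition pick (A : nat -> Prop) (l s : nat) : nat :=
  least (fun x => x = s \/ eligible A l s x).

Fixpoint stage (s : nat) : (nat -> Prop) * nat :=
  match s with
  | 0 => (fun _ => False, 0)
  | S k =>
      let a := pick (fst (stage k)) (snd (stage k)) k in
      (fun x => fst (stage k) x \/ (x = a /\ x < k), a)
  end.

Definition enumerated (s : nat) : nat -> Prop := fst (stage s).
Definition recent (s : nat) : nat := snd (stage s).
Definition limit (x : nat) : Prop := exists s, enumerated s x.

Definition next_set (z : nat) : Prop :=
  exists s, conv (jump X) s p (pair_nat (S m) z).

Lemma pick_spec s :
  recent (S s) <= s /\
  (recent (S s) < s -> eligible (enumerated s) (recent s) s (recent (S s))) /\
  forall x, x < recent (S s) -> ~ eligible (enumerated s) (recent s) s x.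
Proof.
  change (recent (S s)) with (pick (enumerated s) (recent s) s); unfold pick.
  destruct (least_spec (fun x => x = s \/ eligible (enumerated s) (recent s) s x) s)
    as [H L]; auto.
  set (a := least _) in *; split; [|split].
  - destruct (le_lt_dec a s) as [|l]; auto; destruct (L s l); auto.
  - intros; destruct H; [lia|auto].
  - intros x Hx E; apply (L x Hx); auto.
Qed.

Lemma enumerated_S s x :
  enumerated (S s) x <-> enumerated s x \/ (x = recent (S s) /\ x < s).
Proof. reflexivity. Qed.

Lemma enumerated_mono s s' x : s <= s' -> enumerated s x -> enumerated s' x.
Proof. induction 1; auto; rewrite enumerated_S; auto. Qed.

Lemma enumerated_at s x :
  enumerated s x -> exists s', s' < s /\ x = recent (S s') /\ x < s'.
Proof.
  induction s as [|s IH]; [intros []|]; rewrite enumerated_S; intros [H|[-> H]].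
  - destruct (IH H) as (s' & ? & ?); exists s'; split; [lia|auto].
  - exists s; auto.
Qed.

Lemma enumerated_bound s x : enumerated s x -> x < s.
Proof. intros H; apply enumerated_at in H; destruct H as (s' & ? & ? & ?); lia. Qed.

(** A number is enumerated at most once. *)
Lemma recent_tends_to_infinity N :
  exists s0, forall s, s0 <= s -> N <= recent (S s).
Proof.
  induction N as [|N [s0 H0]]; [exists 0; lia|].
  assert (exists s1, s0 <= s1 /\ N < s1 /\ forall s, s1 <= s -> ~ (recent (S s) = N /\ N < s))
    as (s1 & H1 & H2 & H3).
  { destruct (classic (exists s, s0 <= s /\ recent (S s) = N /\ N < s))
      as [(s & Hs & E & HN)|Hno].
    - exists (S s); repeat split; [lia..|]; intros s' Hs' [E' HN'].
      destruct (pick_spec s') as (_ & H & _); rewrite E' in H.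
      destruct (H HN') as [H' _]; apply H'.
      apply (enumerated_mono (S s)); auto; apply enumerated_S; right; split; auto.
    - exists (max s0 (S N)); repeat split; [lia..|]; intros s Hs [E HN].
      apply Hno; exists s; repeat split; auto; lia. }
  exists s1; intros s Hs; specialize (H0 s ltac:(lia)); specialize (H3 s Hs).
  destruct (Nat.eq_dec (recent (S s)) N); [exfalso; apply H3; split; auto; lia|lia].
Qed.

(** Stages after which no smaller number is enumerated.  They exist beyond any
    stage: take the least value that [recent] still attains. *)
Definition true_stage (t : nat) : Prop := forall s, t <= s -> recent (S t) <= recent (S s).

Lemma true_stages_unbounded N : exists t, N <= t /\ true_stage t.
Proof.
  destruct (least_spec (fun v => exists t, N <= t /\ recent (S t) = v) (recent (S N)))
    as [(t & Ht & E) L]; [eauto|].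
  exists t; split; auto; intros s Hs; rewrite E.
  destruct (le_lt_dec (least (fun v => exists t, N <= t /\ recent (S t) = v)) (recent (S s)))
    as [|l]; auto.
  destruct (L _ l); exists s; split; auto; lia.
Qed.

Lemma true_stage_limit t x :
  true_stage t -> x < recent (S t) -> limit x <-> enumerated (S t) x.
Proof.
  intros Ht Hx; split; [|intros; eexists; eauto].
  intros [s Hs]; apply enumerated_at in Hs; destruct Hs as (s' & _ & E & Hs').
  destruct (le_lt_dec t s') as [l|l]; [specialize (Ht _ l); lia|].
  apply (enumerated_mono (S s')); [lia|]; apply enumerated_S; auto.
Qed.

Lemma req_mono e O u u' : u <= u' -> req e O u -> req e O u'.
Proof.
  intros Hu [[He H]|[He H]]; [left|right]; split; auto; revert H.
  - now apply ev_mono.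
  - now apply conv_mono.
Qed.

Lemma req_local e A A' u :
  (forall x, x < u -> A x <-> A' x) -> req e (join A X) u <-> req e (join A' X) u.
Proof.
  intros H; unfold req.
  rewrite (ev_local (join A X) (join A' X)), (conv_local (join A X) (join A' X));
    [tauto|now apply join_local..].
Qed.

Definition satisfied (e : nat) : Prop := exists u, req e (join limit X) u.

Lemma target_mono s s' x : s <= s' -> target s x -> target s' x.
Proof.
  intros Hs [[Hx H]|[Hx H]]; [left|right]; split; auto.
  - revert H; now apply ev_mono.
  - intros w Hw; destruct (H w Hw) as (t & Ht & H'); exists t; split; auto; lia.
Qed.

Lemma limit_target x : limit x -> exists s, target s x.
Proof.
  intros [s Hs]; apply enumerated_at in Hs; destruct Hs as (s' & _ & E & Hs').
  destruct (pick_spec s') as (_ & H & _); rewrite <- E in H.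
  exists s'; now apply H.
Qed.

(** At a true stage the requirements that are heard hold with the correct oracle,
    so they restrain [x] only if they are to restrain it for ever.  Hence at a
    late true stage the missing [x] would be eligible, and the number picked
    would be at most [x], which is impossible that late. *)
Lemma thickness s x :
  target s x -> (forall e, e < pfst x -> satisfied e -> req e (join limit X) x) -> limit x.
Proof.
  intros HT HR; apply NNPP; intros HA.
  destruct (recent_tends_to_infinity (S x)) as [s0 Hs0].
  destruct (true_stages_unbounded (s0 + s + x)) as (t & Ht & HTt).
  destruct (pick_spec (S t)) as (_ & _ & HN).
  apply (HN x); [apply Hs0; lia|].
  assert (Hxt : x < recent (S t)) by (apply Hs0; lia).
  repeat split.
  - intros HE; apply HA; eexists; eauto.
  - revert HT; apply target_mono; lia.
  - intros e He H.
    apply (req_local e limit (enumerated (S t)) x).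
    { intros y Hy; apply true_stage_limit; auto; lia. }
    apply HR; auto; exists (recent (S t)); revert H.
    apply req_local; intros y Hy; now apply true_stage_limit.
Qed.

(** From stage [s] on, [v], the least use with which the requirement then holds,
    stays a use: the columns up to [e] are correct below it, and the higher ones
    are restrained because [recent] never falls below [v].  Both facts are
    proved together by induction on the stage. *)
Lemma preservation s e u :
  u <= recent (S s) -> req e (join (enumerated (S s)) X) u ->
  (forall x, x < u -> pfst x <= e -> limit x -> enumerated (S s) x) ->
  req e (join limit X) u.
Proof.
  intros Hu HR HC.
  set (v := least (req e (join (enumerated (S s)) X))).
  destruct (least_spec (req e (join (enumerated (S s)) X)) u HR) as [Hv L]; fold v in Hv, L.
  assert (v <= u) as Hvu by (destruct (le_lt_dec v u) as [|l]; auto; destruct (L u l); auto).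
  assert (forall s', s <= s' ->
    v <= recent (S s') /\ forall x, x < v -> enumerated (S s') x <-> enumerated (S s) x) as HI.
  { induction 1 as [|s' Hs' [IH1 IH2]]; [split; [lia|tauto]|].
    destruct (pick_spec (S s')) as (_ & HE & _).
    assert (v <= recent (S (S s'))) as H1.
    { destruct (le_lt_dec v (recent (S (S s')))) as [|l]; auto; exfalso.
      set (y := recent (S (S s'))) in *.
      assert (y < S s') as Hy by (pose proof (proj1 (pick_spec s')); lia).
      destruct (HE Hy) as (HE1 & _ & HE3).
      destruct (le_lt_dec (pfst y) e) as [l'|l'].
      - apply HE1, IH2; auto; apply HC; auto; [lia|].
        exists (S (S s')); apply enumerated_S; auto.
      - apply (L y l); apply (req_local e (enumerated (S s')) (enumerated (S s)) y).
        { intros x Hx; apply IH2; lia. }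
        apply HE3; auto; apply (req_mono e _ v); auto.
        now apply (req_local e (enumerated (S s')) (enumerated (S s)) v). }
    split; auto; intros x Hx; rewrite enumerated_S, IH2 by auto.
    split; [intros [H|[-> _]]; [auto|lia]|auto]. }
  apply (req_mono e _ v); auto.
  apply (req_local e limit (enumerated (S s)) v); auto; intros x Hx; split.
  2: { intros H; eexists; eauto. }
  intros [s' H]; apply (HI (max s s')); [lia|auto|].
  revert H; apply enumerated_mono; lia.
Qed.

(** A late true stage sees the final computation. *)
Lemma settling e u :
  req e (join limit X) u ->
  exists s, u <= recent (S s) /\ req e (join (enumerated (S s)) X) u /\
    forall x, x < u -> limit x -> enumerated (S s) x.
Proof.
  intros H; destruct (recent_tends_to_infinity u) as [s0 H0].
  destruct (true_stages_unbounded s0) as (t & Ht & HT).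
  exists t; repeat split; auto.
  - revert H; apply req_local; intros x Hx; symmetry; apply true_stage_limit; auto.
    specialize (H0 t Ht); lia.
  - intros x Hx; apply true_stage_limit; auto; specialize (H0 t Ht); lia.
Qed.

Lemma pfst_0 : pfst 0 = 0.
Proof. pose proof (psnd_le 0); lia. Qed.

Lemma limit_0 : limit 0 <-> exists s, ev X s m m 0.
Proof.
  split.
  - intros H; apply limit_target in H; destruct H as (s & [[_ H]|[H _]]); [eauto|].
    rewrite pfst_0 in H; lia.
  - intros [s H]; apply (thickness s); [left; auto|].
    rewrite pfst_0; lia.
Qed.

Lemma limit_column_0 x : pfst x = 0 -> limit x -> x = 0.
Proof.
  intros E H; apply limit_target in H; destruct H as (s & [[H _]|[H _]]); [auto|lia].
Qed.

Lemma approx_mono t t' q : t <= t' -> approx t q -> approx t' q.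
Proof. apply conv_mono. Qed.

(** The limit lemma for one computation with oracle the jump of [X]: only
    finitely many queries have to settle. *)
Lemma next_set_unrefuted z : next_set z <-> exists w, forall t, ~ refuted z w t.
Proof.
  split.
  - intros [s Hs].
    destruct (finite_collection (fun q t => jump X q -> approx t q) s) as [t Ht].
    + intros q t t' Htt H HJ; apply (approx_mono t); auto.
    + intros q _; destruct (classic (jump X q)) as [J|J]; [|exists 0; tauto].
      apply conv_jump in J; destruct J as [d Hd]; exists d; auto.
    + assert (E : forall q, q < s -> jump X q <-> approx t q).
      { intros q Hq; split; auto; intros H; apply conv_jump; exists t; auto. }
      exists (pair_nat s t); intros t'; unfold refuted; rewrite pfst_pair, psnd_pair.
      intros [H|(q & Hq & H1 & H2)].
      * apply H; now apply (conv_local (jump X) (approx t) s).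
      * apply H2, E; auto; apply conv_jump; exists t'; auto.
  - intros [w Hw]; exists (pfst w).
    assert (conv (approx (psnd w)) (pfst w) p (pair_nat (S m) z)) as H.
    { apply NNPP; intros N; apply (Hw 0); left; auto. }
    apply (conv_local (jump X) (approx (psnd w)) (pfst w)); auto; intros q Hq; split.
    + intros J; apply conv_jump in J; destruct J as [t Ht]; apply NNPP; intros N.
      apply (Hw t); right; eauto.
    + intros J; apply conv_jump; exists (psnd w); auto.
Qed.

Lemma column_full z x : ~ next_set z -> pfst x = S z -> exists s, target s x.
Proof.
  intros HZ Hx.
  destruct (finite_collection (fun w s => exists t, t < s /\ refuted z w t) (S (psnd x)))
    as [s Hs].
  - intros w t t' Ht (t0 & H & H'); exists t0; split; auto; lia.
  - intros w _; apply NNPP; intros N; apply HZ, next_set_unrefuted; exists w.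
    intros t Ht; apply N; exists (S t), t; auto.
  - exists s; right; rewrite Hx; split; [lia|exact Hs].
Qed.

Lemma column_finite z : next_set z -> exists M, forall x, pfst x = S z -> limit x -> x < M.
Proof.
  intros HZ; apply next_set_unrefuted in HZ; destruct HZ as [w Hw].
  exists (pair_nat (S z) w); intros x Hx H; apply limit_target in H.
  destruct H as [s [[-> _]|[_ H]]]; [rewrite pfst_0 in Hx; lia|].
  rewrite Hx in H; rewrite <- (pair_surj x), Hx; apply pair_mono_r.
  destruct (le_lt_dec w (psnd x)) as [l|l]; auto.
  destruct (H w) as (t & _ & Ht); [lia|]; destruct (Hw t); auto.
Qed.

(** [N] bounds the permanent restraint of all requirements below [e]. *)
Definition bounds_uses (N e : nat) : Prop :=
  forall e', e' < e -> satisfied e' -> req e' (join limit X) N.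

Lemma use_bound_exists e : exists N, bounds_uses N e.
Proof.
  destruct (finite_collection (fun e' N => satisfied e' -> req e' (join limit X) N) e)
    as [N HN].
  - intros e' N N' HN H Hs; apply (req_mono e' _ N); auto.
  - intros e' _; destruct (classic (satisfied e')) as [[u Hu]|]; [exists u; auto|].
    exists 0; tauto.
  - exists N; exact HN.
Qed.

(** The exceptions in a full column lie below the uses of the finitely many
    requirements that may restrain it. *)
Lemma column_cofinite z N x :
  ~ next_set z -> bounds_uses N (S z) -> pfst x = S z -> N <= x -> limit x.
Proof.
  intros HZ HN Hx Hle; destruct (column_full z x HZ Hx) as [s Hs].
  apply (thickness s); auto; rewrite Hx; intros e He H.
  apply (req_mono e _ N); auto.
Qed.

End Construction.

(** * Computability of the construction *)
Lemma dec_refuted C (X : idx C -> nat -> Prop) p m z w t :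
  dec (ext C) (fun i => X (fst i) (snd i)) -> comp C p -> comp C m -> comp C z ->
  comp C w -> comp C t ->
  dec C (fun i => refuted (X i) (p i) (m i) (z i) (w i) (t i)).
Proof.
  intros; unfold refuted, approx; comp_auto.
Qed.

Lemma dec_target C (X : idx C -> nat -> Prop) p m s x :
  dec (ext C) (fun i => X (fst i) (snd i)) -> comp C p -> comp C m -> comp C s ->
  comp C x ->
  dec C (fun i => target (X i) (p i) (m i) (s i) (x i)).
Proof.
  intros; unfold target; comp_auto.
  apply (dec_refuted (ext (ext C)) (fun i => X (fst (fst i)))); comp_auto.
Qed.

Lemma dec_join C (A X : idx C -> nat -> Prop) q :
  dec (ext C) (fun i => A (fst i) (snd i)) -> dec (ext C) (fun i => X (fst i) (snd i)) ->
  comp C q -> dec C (fun i => join (A i) (X i) (q i)).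
Proof. intros; unfold join; comp_auto. Qed.

Lemma dec_req C (O : idx C -> nat -> Prop) m e u :
  dec (ext C) (fun i => O (fst i) (snd i)) -> comp C m -> comp C e -> comp C u ->
  dec C (fun i => req (m i) (e i) (O i) (u i)).
Proof. intros; unfold req; comp_auto. Qed.

Ltac comp_known_stage ::=
  match goal with
  | |- dec ?C (fun i => join (@?A i) (@?X i) (@?q i)) => apply (dec_join C A X q)
  | |- dec ?C (fun i => target (@?X i) (@?p i) (@?m i) (@?s i) (@?x i)) =>
      apply (dec_target C X p m s x)
  | |- dec ?C (fun i => req (@?m i) (@?e i) (@?O i) (@?u i)) => apply (dec_req C O m e u)
  end.

Lemma comp_pick C (X A : idx C -> nat -> Prop) p m l s :
  dec (ext C) (fun i => X (fst i) (snd i)) -> dec (ext C) (fun i => A (fst i) (snd i)) ->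
  comp C p -> comp C m -> comp C l -> comp C s ->
  comp C (fun i => pick (X i) (p i) (m i) (A i) (l i) (s i)).
Proof.
  intros; unfold pick.
  apply (comp_least C (fun i x => x = s i \/ eligible (X i) (p i) (m i) (A i) (l i) (s i) x)).
  - unfold eligible; comp_auto.
  - intros i; exists (s i); auto.
Qed.

Definition stage_code (X : nat -> Prop) (p m s : nat) : nat :=
  pair_nat (bits (enumerated X p m s) s) (recent X p m s).

Lemma stage_code_mem X p m s : mem (pfst (stage_code X p m s)) = enumerated X p m s.
Proof.
  extensionality x; apply propositional_extensionality; unfold stage_code.
  rewrite pfst_pair, mem_bits; split; [tauto|].
  intros H; split; auto; now apply enumerated_bound in H.
Qed.

Lemma stage_code_recent X p m s : psnd (stage_code X p m s) = recent X p m s.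
Proof. apply psnd_pair. Qed.

Lemma comp_stage C (X : idx C -> nat -> Prop) p m s :
  dec (ext C) (fun i => X (fst i) (snd i)) -> comp C p -> comp C m -> comp C s ->
  comp C (fun i => stage_code (X i) (p i) (m i) (s i)).
Proof.
  intros HX Hp Hm.
  apply (comp_rec_at C (fun i s => stage_code (X i) (p i) (m i) s)).
  - exact (comp_const C (pair_nat (pair_nat 0 0) 0)).
  - set (f := fun i s => stage_code (X i) (p i) (m i) s).
    set (a := fun i : idx C * nat => pick (X (fst i)) (p (fst i)) (m (fst i))
      (mem (pfst (f (fst i) (snd i)))) (psnd (f (fst i) (snd i))) (snd i)).
    apply (comp_eq (ext_val C f) (fun i => pair_nat (bits (fun x =>
      mem (pfst (f (fst i) (snd i))) x \/ (x = a i /\ x < snd i)) (S (snd i))) (a i))).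
    { intros [i n]; unfold a, f; cbn [fst snd].
      rewrite stage_code_mem, stage_code_recent; reflexivity. }
    assert (comp (ext_val C f) a).
    { apply (comp_pick (ext_val C f) (fun i => X (fst i))
        (fun i => mem (pfst (f (fst i) (snd i))))); comp_auto. }
    apply comp_pair; auto.
    apply (comp_bits (ext_val C f) _ (fun i x =>
      mem (pfst (f (fst i) (snd i))) x \/ (x = a i /\ x < snd i))); comp_auto.
Qed.

Lemma dec_enumerated C (X : idx C -> nat -> Prop) p m s x :
  dec (ext C) (fun i => X (fst i) (snd i)) -> comp C p -> comp C m -> comp C s -> comp C x ->
  dec C (fun i => enumerated (X i) (p i) (m i) (s i) (x i)).
Proof.
  intros; apply (dec_iff C (fun i => mem (pfst (stage_code (X i) (p i) (m i) (s i))) (x i))).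
  { intros; now rewrite stage_code_mem. }
  apply dec_mem; auto; now apply comp_pfst, comp_stage.
Qed.

Lemma comp_recent C (X : idx C -> nat -> Prop) p m s :
  dec (ext C) (fun i => X (fst i) (snd i)) -> comp C p -> comp C m -> comp C s ->
  comp C (fun i => recent (X i) (p i) (m i) (s i)).
Proof.
  intros; apply (comp_eq C (fun i => psnd (stage_code (X i) (p i) (m i) (s i)))).
  { intros; apply stage_code_recent. }
  now apply comp_psnd, comp_stage.
Qed.

Ltac comp_known_stage ::=
  match goal with
  | |- dec ?C (fun i => join (@?A i) (@?X i) (@?q i)) => apply (dec_join C A X q)
  | |- dec ?C (fun i => req (@?m i) (@?e i) (@?O i) (@?u i)) => apply (dec_req C O m e u)
  | |- dec ?C (fun i => enumerated (@?X i) (@?p i) (@?m i) (@?s i) (@?x i)) =>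
      apply (dec_enumerated C X p m s x)
  | |- comp ?C (fun i => recent (@?X i) (@?p i) (@?m i) (@?s i)) =>
      apply (comp_recent C X p m s)
  end.

Ltac pairs := repeat (rewrite pfst_pair || rewrite psnd_pair).

(** * The tower of levels *)

(** A program that enumerates, at every level, the set constructed with its own
    index as the index for the next level. *)
Lemma self_reference :
  exists c, forall X m x,
    (exists y, eval X c (pair_nat m x) y) <-> limit X (encode c) m x.
Proof.
  set (C := Ctx ((nat -> Prop) * nat) fst snd).
  destruct (sd_ex C (fun i s => enumerated (fst i) (pfst (snd i)) (pfst (psnd (snd i))) s
    (psnd (psnd (snd i))))) as [F HF].
  - assert (dec (ext (ext C)) (fun i => fst (fst (fst i)) (snd i))).
    { exact (dec_orc (ext (ext C)) (fun i => snd i) (comp_var (ext C))). }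
    assert (comp C (fun i => snd i)) by apply (comp_inp C).
    apply (dec_enumerated (ext C) (fun i => fst (fst i))); comp_auto; auto.
  - destruct (recursion_theorem F) as [c Hc]; exists c; intros X m x.
    specialize (HF (X, pair_nat (encode c) (pair_nat m x))); cbn [C orc inp fst snd] in HF.
    rewrite !pfst_pair, !psnd_pair, !pfst_pair in HF.
    unfold limit; rewrite HF; split; intros [y Hy]; exists y; now apply Hc.
Qed.

Definition zero_jump (m : nat) : nat -> Prop := jumps m emptyset.

Section Family.

Variable p : nat.

Definition tower (m : nat) : nat -> Prop := limit (zero_jump m) p m.
Definition tower_oracle (m : nat) : nat -> Prop := join (tower m) (zero_jump m).

(** The defining property of the index from [self_reference]. *)
Hypothesis Hp : forall m z, next_set (zero_jump m) p m z <-> tower (S m) z.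

Definition zero_jump_ctx : ctx := Ctx nat (fun t => zero_jump (pfst t)) (fun t => t).

(** The index of the question is computed from its data, which leaves one query
    to [0^(m+1)]. *)
Lemma dec_sd_at D m y (R : nat -> Prop) :
  dec (ext D) (fun i => zero_jump (S (m (fst i))) (snd i)) -> comp D m -> comp D y ->
  sd zero_jump_ctx R -> dec D (fun i => R (pair_nat (m i) (y i))).
Proof.
  intros HK Hm Hy HR; apply dec_jump_sd in HR; destruct HR as [v Hv].
  apply (comp_Phi D (fun i => zero_jump (S (m i))) (fun _ => encode v)
    (fun i => pair_nat (m i) (y i))); comp_auto.
  intros i; exists v; split; auto.
  specialize (Hv (pair_nat (m i) (y i))); cbn in Hv; now rewrite pfst_pair in Hv.
Qed.

Lemma zero_jump_ctx_orc : dec (ext zero_jump_ctx) (fun i => zero_jump (pfst (fst i)) (snd i)).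
Proof. exact (dec_orc (ext zero_jump_ctx) (fun i => snd i) (comp_var _)). Qed.

Lemma zero_jump_ctx_id : comp zero_jump_ctx (fun t => t).
Proof. exact (comp_inp zero_jump_ctx). Qed.

Ltac comp_zero_jump :=
  match goal with
  | |- dec ?C (fun i => zero_jump (pfst (@?t i)) (@?x i)) =>
      refine (comp_sub (ext zero_jump_ctx) C (fun i => (t i, x i)) _ (fun _ => eq_refl) _ zero_jump_ctx_orc);
      cbn [inp ext zero_jump_ctx fst snd]
  | |- comp zero_jump_ctx (fun t => t) => exact zero_jump_ctx_id
  end.

Lemma dec_tower D m x :
  dec (ext D) (fun i => zero_jump (S (m (fst i))) (snd i)) -> comp D m -> comp D x ->
  dec D (fun i => tower (m i) (x i)).
Proof.
  intros HK Hm Hx.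
  apply (dec_iff D (fun i => (fun t => exists s,
    enumerated (zero_jump (pfst t)) p (pfst t) s (psnd t)) (pair_nat (m i) (x i)))).
  { intros i; cbn beta; rewrite pfst_pair, psnd_pair; reflexivity. }
  apply (dec_sd_at D m x (fun t => exists s,
    enumerated (zero_jump (pfst t)) p (pfst t) s (psnd t))); auto.
  apply (sd_ex zero_jump_ctx (fun t s => enumerated (zero_jump (pfst t)) p (pfst t) s (psnd t))).
  pose proof zero_jump_ctx_id; repeat (comp_step || comp_zero_jump).
Qed.

(** With [d] the full columns, its negation says that [M] is beyond all elements
    of the finite columns up to [e]. *)
Definition tail (m e M d : nat) : Prop :=
  exists x, M <= x /\ pfst x <= e /\ ~ mem d (pfst x) /\ tower m x.

(** Whether requirement [e] is ever seen with a computation that agrees with the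
    expected contents of the columns up to [e]: the finite set [g] below [M], and
    everything in the columns in [d] from [M] on.  All the information on the
    final set is passed in numbers, which makes this a single question to
    [0^(m+1)]. *)
Definition query (m e M g d : nat) : Prop :=
  exists s u, u <= recent (zero_jump m) p m (S s) /\
    req m e (join (enumerated (zero_jump m) p m (S s)) (zero_jump m)) u /\
    forall x, x < u ->
      pfst x <= e -> (x < M /\ mem g x) \/ (M <= x /\ mem d (pfst x)) ->
      enumerated (zero_jump m) p m (S s) x.

(** If the expectation is correct, a computation that agrees with it is preserved,
    and the final computation is one. *)
Lemma query_satisfied m e M g d :
  (forall x, pfst x <= e -> x < M -> (mem g x <-> tower m x)) ->
  (forall x, pfst x <= e -> M <= x -> (mem d (pfst x) <-> tower m x)) ->
  query m e M g d <-> satisfied (zero_jump m) p m e.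
Proof.
  intros Hg Hd; split.
  - intros (s & u & H1 & H2 & H3); exists u; apply (preservation _ _ _ s); auto.
    intros x Hx He HA; apply H3; auto.
    destruct (le_lt_dec M x) as [l|l]; [right|left]; split; auto.
    + now apply Hd.
    + now apply Hg.
  - intros [u Hu]; apply settling in Hu; destruct Hu as (s & H1 & H2 & H3).
    exists s, u; repeat split; auto; intros x Hx He H; apply H3; auto.
    destruct H as [[H H']|[H H']]; [apply Hg in H'|apply Hd in H']; auto.
Qed.

Lemma dec_tail D m e M d :
  dec (ext D) (fun i => zero_jump (S (m (fst i))) (snd i)) ->
  comp D m -> comp D e -> comp D M -> comp D d ->
  dec D (fun i => tail (m i) (e i) (M i) (d i)).
Proof.
  intros HK Hm He HM Hd.
  set (R := fun t x s => pfst (psnd (psnd t)) <= x /\ pfst x <= pfst (psnd t) /\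
    ~ mem (psnd (psnd (psnd t))) (pfst x) /\ enumerated (zero_jump (pfst t)) p (pfst t) s x).
  apply (dec_iff D (fun i => (fun t => exists k, R t (pfst k) (psnd k))
    (pair_nat (m i) (pair_nat (e i) (pair_nat (M i) (d i)))))).
  { intros i; cbn beta; unfold R, tail.
    pairs.
    split.
    - intros (k & H1 & H2 & H3 & H4); exists (pfst k); repeat split; auto.
      now exists (psnd k).
    - intros (x & H1 & H2 & H3 & s & H4); exists (pair_nat x s).
      rewrite pfst_pair, psnd_pair; auto. }
  apply (dec_sd_at D m _ (fun t => exists k, R t (pfst k) (psnd k))); auto; [comp_auto|].
  apply (sd_ex zero_jump_ctx (fun t k => R t (pfst k) (psnd k))); unfold R.
  pose proof zero_jump_ctx_id; repeat (comp_step || comp_zero_jump).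
Qed.

Lemma dec_query D m e M g d :
  dec (ext D) (fun i => zero_jump (S (m (fst i))) (snd i)) ->
  comp D m -> comp D e -> comp D M -> comp D g -> comp D d ->
  dec D (fun i => query (m i) (e i) (M i) (g i) (d i)).
Proof.
  intros HK Hm He HM Hg Hd.
  set (R := fun t s u =>
    let m := pfst t in let e := pfst (psnd t) in let M := pfst (psnd (psnd t)) in
    let g := pfst (psnd (psnd (psnd t))) in let d := psnd (psnd (psnd (psnd t))) in
    u <= recent (zero_jump m) p m (S s) /\
    req m e (join (enumerated (zero_jump m) p m (S s)) (zero_jump m)) u /\
    forall x, x < u ->
      pfst x <= e -> (x < M /\ mem g x) \/ (M <= x /\ mem d (pfst x)) ->
      enumerated (zero_jump m) p m (S s) x).
  apply (dec_iff D (fun i => (fun t => exists k, R t (pfst k) (psnd k))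
    (pair_nat (m i) (pair_nat (e i) (pair_nat (M i) (pair_nat (g i) (d i))))))).
  { intros i; cbn beta; unfold R, query; cbv zeta.
    pairs.
    split.
    - intros (k & H); exists (pfst k), (psnd k); exact H.
    - intros (s & u & H); exists (pair_nat s u); now rewrite pfst_pair, psnd_pair. }
  apply (dec_sd_at D m _ (fun t => exists k, R t (pfst k) (psnd k))); auto; [comp_auto|].
  apply (sd_ex zero_jump_ctx (fun t k => R t (pfst k) (psnd k))); unfold R; cbv zeta.
  pose proof zero_jump_ctx_id; repeat (comp_step || comp_zero_jump).
Qed.

Lemma mem_0 x : ~ mem 0 x.
Proof. unfold mem; rewrite pfst_0; lia. Qed.

(** Requirement [0] has to anticipate column [0] alone, that is, one bit of the
    set, and this bit is known to [0^(m+1)]. *)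
Lemma dec_satisfied_0 D m :
  dec (ext D) (fun i => zero_jump (S (m (fst i))) (snd i)) -> comp D m ->
  dec D (fun i => satisfied (zero_jump (m i)) p (m i) 0).
Proof.
  intros HK Hm.
  apply (dec_iff D (fun i => query (m i) 0 1 (bits (tower (m i)) 1) 0)).
  - intros i; apply query_satisfied.
    + intros x _ Hx; rewrite mem_bits; tauto.
    + intros x Hx Hx'; split; intros H; [now apply mem_0 in H|].
      apply limit_column_0 in H; lia.
  - apply (dec_query D m (fun _ => 0) (fun _ => 1) (fun i => bits (tower (m i)) 1) (fun _ => 0));
      comp_auto.
    apply (comp_bits D _ (fun i => tower (m i))); [|comp_auto].
    apply (dec_tower (ext D) (fun i => m (fst i)) snd); comp_auto.
    apply (comp_sub (ext D) (ext (ext D)) (fun i => (fst (fst i), snd i))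
      (fun i => chi (zero_jump (S (m (fst i))) (snd i))) (fun _ => eq_refl)); [|exact HK].
    cbn [inp ext fst snd]; comp_auto.
Qed.

Definition infinite_columns (m e : nat) : nat :=
  bits (fun c => 0 < c /\ ~ tower (S m) (pred c)) (S e).

Definition settle_bound (m e N : nat) : nat :=
  least (fun M => N <= M /\ ~ tail m e M (infinite_columns m e)).

(** The answer about requirement [e], given a bound [N] on the uses of the
    previous requirements. *)
Definition verdict (m e N : nat) : Prop :=
  query m e (settle_bound m e N) (bits (tower m) (settle_bound m e N)) (infinite_columns m e).

Lemma mem_infinite_columns m e c :
  c <= e -> mem (infinite_columns m e) c <-> 0 < c /\ ~ tower (S m) (pred c).
Proof.
  intros H; unfold infinite_columns; rewrite mem_bits; split; [tauto|].
  split; [lia|auto].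
Qed.

Lemma settle_bound_exists m e N :
  exists M, N <= M /\ ~ tail m e M (infinite_columns m e).
Proof.
  destruct (finite_collection (fun c M => ~ mem (infinite_columns m e) c ->
    forall x, pfst x = c -> tower m x -> x < M) (S e)) as [M HM].
  - intros c M M' HM H Hc x Hx HA; specialize (H Hc x Hx HA); lia.
  - intros c Hc; cbn beta; destruct c as [|z].
    + exists 1; intros _ x Hx HA; apply limit_column_0 in HA; auto; lia.
    + destruct (classic (tower (S m) z)) as [HA|HA].
      * apply Hp, column_finite in HA; destruct HA as [M HM]; exists M; intros _; exact HM.
      * exists 0; intros H; destruct H; apply mem_infinite_columns; [lia|split; [lia|exact HA]].
  - exists (max N M); split; [lia|]; intros (x & H1 & H2 & H3 & H4).
    specialize (HM (pfst x) ltac:(lia) H3 x eq_refl H4); lia.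
Qed.

(** Beyond [N] the full columns contain everything, and beyond the settling bound
    the others contain nothing. *)
Lemma verdict_satisfied m e N :
  bounds_uses (zero_jump m) p m N e -> verdict m e N <-> satisfied (zero_jump m) p m e.
Proof.
  intros HN; destruct (settle_bound_exists m e N) as [M0 HM0].
  destruct (least_spec (fun M => N <= M /\ ~ tail m e M (infinite_columns m e)) M0 HM0)
    as [[H1 H2] _]; fold (settle_bound m e N) in H1, H2.
  apply query_satisfied.
  - intros x _ Hx; rewrite mem_bits; tauto.
  - intros x He Hx; split.
    + rewrite mem_infinite_columns by auto; intros [Hc HA].
      apply (column_cofinite (zero_jump m) p m (pred (pfst x)) N); [| |lia|lia].
      * now rewrite Hp.
      * intros e' He'; apply HN; lia.
    + intros HA; apply NNPP; intros Hm; apply H2; exists x; auto.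
Qed.

Definition use_bound (m e : nat) : nat := least (fun N => bounds_uses (zero_jump m) p m N e).

Lemma use_bound_spec m e : bounds_uses (zero_jump m) p m (use_bound m e) e.
Proof.
  destruct (use_bound_exists (zero_jump m) p m e) as [N HN].
  exact (proj1 (least_spec (fun N => bounds_uses (zero_jump m) p m N e) N HN)).
Qed.

Lemma bounds_uses_mono m N N' e :
  N <= N' -> bounds_uses (zero_jump m) p m N e -> bounds_uses (zero_jump m) p m N' e.
Proof. intros HN H e' He' Hs; apply (req_mono m e' _ N); auto. Qed.

Lemma use_bound_0 m : use_bound m 0 = 0.
Proof.
  destruct (least_spec (fun N => bounds_uses (zero_jump m) p m N 0) 0) as [_ L]; [intros e; lia|].
  fold (use_bound m 0) in L; destruct (use_bound m 0) as [|n]; auto.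
  destruct (L 0); [lia|intros e; lia].
Qed.

(** Since the bound reached at [e] makes the verdict correct, the next bound can
    be computed from it; along this recursion the satisfied requirements are
    found out one after the other. *)
Lemma use_bound_S m e :
  use_bound m (S e) = least (fun N => use_bound m e <= N /\
    (verdict m e (use_bound m e) -> req m e (join (tower m) (zero_jump m)) N)).
Proof.
  unfold use_bound at 1; f_equal; extensionality N; apply propositional_extensionality.
  rewrite (verdict_satisfied m e _ (use_bound_spec m e)); split.
  - intros H; split.
    + assert (bounds_uses (zero_jump m) p m N e) as HN by (intros e' He'; apply H; lia).
      destruct (least_spec (fun N => bounds_uses (zero_jump m) p m N e) N HN) as [_ L].
      destruct (le_lt_dec (use_bound m e) N) as [|l]; auto; destruct (L N l HN).
    + apply H; lia.
  - intros [HN H] e' He'.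
    destruct (Nat.eq_dec e' e) as [->|]; auto.
    apply (bounds_uses_mono m (use_bound m e) N e HN (use_bound_spec m e)); lia.
Qed.

Lemma widen D f (Q : idx D -> nat -> Prop) :
  dec (ext D) (fun i => Q (fst i) (snd i)) ->
  dec (ext (ext_val D f)) (fun i => Q (fst (fst i)) (snd i)).
Proof. intros; comp_auto. Qed.

Lemma weaken D (Q : idx D -> nat -> Prop) :
  dec (ext D) (fun i => Q (fst i) (snd i)) ->
  dec (ext (ext D)) (fun i => Q (fst (fst i)) (snd i)).
Proof. intros; comp_auto. Qed.

Section Level.

Variables (D : ctx) (m : idx D -> nat).
Hypothesis HK : dec (ext D) (fun i => zero_jump (S (m (fst i))) (snd i)).
Hypothesis HA : dec (ext D) (fun i => tower (S (m (fst i))) (snd i)).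
Hypothesis Hm : comp D m.

Lemma comp_infinite_columns e :
  comp D e -> comp D (fun i => infinite_columns (m i) (e i)).
Proof.
  intros He; apply (comp_bits D (fun i => S (e i)) (fun i c => 0 < c /\ ~ tower (S (m i)) (pred c)));
    [|comp_auto].
  set (Q := fun i => tower (S (m i))).
  change (dec (ext D) (fun i => Q (fst i) (snd i))) in HA.
  change (dec (ext D) (fun i => 0 < snd i /\ ~ Q (fst i) (pred (snd i)))).
  comp_auto.
Qed.

Lemma comp_settle_bound e N :
  comp D e -> comp D N -> comp D (fun i => settle_bound (m i) (e i) (N i)).
Proof.
  intros He HN; pose proof (comp_infinite_columns e He).
  apply (comp_least D (fun i M => N i <= M /\
    ~ tail (m i) (e i) M (infinite_columns (m i) (e i)))).
  - set (d := fun i => infinite_columns (m i) (e i)) in *.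
    comp_auto. apply (dec_tail (ext D) (fun i => m (fst i)) (fun i => e (fst i)) snd
      (fun i => d (fst i))); comp_auto.
    apply (weaken D (fun i => zero_jump (S (m i)))), HK.
  - intros i; apply settle_bound_exists.
Qed.

Lemma dec_verdict e N :
  comp D e -> comp D N -> dec D (fun i => verdict (m i) (e i) (N i)).
Proof.
  intros He HN; pose proof (comp_settle_bound e N He HN).
  pose proof (comp_infinite_columns e He).
  apply (dec_query D m e (fun i => settle_bound (m i) (e i) (N i))
    (fun i => bits (tower (m i)) (settle_bound (m i) (e i) (N i)))
    (fun i => infinite_columns (m i) (e i))); auto.
  apply (comp_bits D (fun i => settle_bound (m i) (e i) (N i)) (fun i => tower (m i))); auto.
  apply (dec_tower (ext D) (fun i => m (fst i)) snd); comp_auto.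
  apply (weaken D (fun i => zero_jump (S (m i)))), HK.
Qed.

End Level.

Lemma dec_zero_jump_below D m x :
  dec (ext D) (fun i => zero_jump (S (m (fst i))) (snd i)) -> comp D m -> comp D x ->
  dec D (fun i => zero_jump (m i) (x i)).
Proof.
  intros HK Hm Hx.
  apply (dec_iff D (fun i => (fun t => zero_jump (pfst t) (psnd t)) (pair_nat (m i) (x i)))).
  { intros i; cbn beta; now rewrite pfst_pair, psnd_pair. }
  apply (dec_sd_at D m x (fun t => zero_jump (pfst t) (psnd t))); auto.
  apply dec_sd; pose proof zero_jump_ctx_id; repeat (comp_step || comp_zero_jump).
Qed.

Lemma comp_use_bound D m e :
  dec (ext D) (fun i => zero_jump (S (m (fst i))) (snd i)) ->
  dec (ext D) (fun i => tower (S (m (fst i))) (snd i)) ->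
  comp D m -> comp D e -> comp D (fun i => use_bound (m i) (e i)).
Proof.
  intros HK HA Hm; apply (comp_rec_at D (fun i e => use_bound (m i) e)).
  - apply (comp_eq D (fun _ => 0)); [intros; now rewrite use_bound_0|apply comp_const].
  - set (f := fun i e => use_bound (m i) e).
    apply (comp_eq (ext_val D f) (fun i => least (fun N => f (fst i) (snd i) <= N /\
      (verdict (m (fst i)) (snd i) (f (fst i) (snd i)) ->
        req (m (fst i)) (snd i) (join (tower (m (fst i))) (zero_jump (m (fst i)))) N)))).
    { intros [i n]; unfold f; cbn [fst snd]; now rewrite use_bound_S. }
    pose proof (widen D f (fun i => zero_jump (S (m i))) HK) as HK'.
    pose proof (widen D f (fun i => tower (S (m i))) HA) as HA'.
    cbn beta in HK', HA'.
    assert (HV : dec (ext_val D f) (fun i => verdict (m (fst i)) (snd i) (f (fst i) (snd i)))).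
    { apply (dec_verdict (ext_val D f) (fun i => m (fst i)) HK' HA'); comp_auto. }
    apply (comp_least (ext_val D f) (fun i N => f (fst i) (snd i) <= N /\
      (verdict (m (fst i)) (snd i) (f (fst i) (snd i)) ->
        req (m (fst i)) (snd i) (join (tower (m (fst i))) (zero_jump (m (fst i)))) N))).
    + set (Q := fun i : idx (ext_val D f) => verdict (m (fst i)) (snd i) (f (fst i) (snd i))) in *.
      set (AQ := fun i : idx D => tower (m i)). set (KQ := fun i : idx D => zero_jump (m i)).
      assert (HAQ : dec (ext D) (fun i => AQ (fst i) (snd i))).
      { apply (dec_tower (ext D) (fun i => m (fst i)) snd); comp_auto.
        apply (weaken D (fun i => zero_jump (S (m i)))), HK. }
      assert (HKQ : dec (ext D) (fun i => KQ (fst i) (snd i))).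
      { apply (dec_zero_jump_below (ext D) (fun i => m (fst i)) snd); comp_auto.
        apply (weaken D (fun i => zero_jump (S (m i)))), HK. }
      change (dec (ext (ext_val D f)) (fun i => f (fst (fst i)) (snd (fst i)) <= snd i /\
        (Q (fst i) -> req (m (fst (fst i))) (snd (fst i))
          (join (AQ (fst (fst i))) (KQ (fst (fst i)))) (snd i)))).
      comp_auto.
    + intros [i n]; unfold f; cbn [fst snd].
      exists (use_bound (m i) (S n)); split.
      * assert (bounds_uses (zero_jump (m i)) p (m i) (use_bound (m i) (S n)) n) as HN
          by (intros e' He'; apply use_bound_spec; lia).
        destruct (least_spec (fun N => bounds_uses (zero_jump (m i)) p (m i) N n) _ HN) as [_ L].
        destruct (le_lt_dec (use_bound (m i) n) (use_bound (m i) (S n))) as [|l]; auto.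
        destruct (L _ l HN).
      * rewrite verdict_satisfied by apply use_bound_spec.
        apply use_bound_spec; lia.
Qed.

Lemma jump_tower_satisfied m q : jump (tower_oracle m) q <-> satisfied (zero_jump m) p m (S q).
Proof.
  rewrite jump_conv; unfold satisfied, req; split; intros [u H]; exists u.
  - right; split; [lia|exact H].
  - destruct H as [[H _]|[_ H]]; [discriminate|exact H].
Qed.

(** Requirement [q + 1] carries the question, and level [m + 1] supplies both the
    next jump and the information which columns are full. *)
Lemma dec_jump_tower D m q :
  dec (ext D) (fun i => tower_oracle (S (m (fst i))) (snd i)) -> comp D m -> comp D q ->
  dec D (fun i => jump (tower_oracle (m i)) (q i)).
Proof.
  intros HO Hm Hq.
  set (Q := fun i => tower_oracle (S (m i))).
  change (dec (ext D) (fun i => Q (fst i) (snd i))) in HO.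
  assert (HK : dec (ext D) (fun i => zero_jump (S (m (fst i))) (snd i))).
  { apply (dec_iff (ext D) (fun i => Q (fst i) (pair_nat 1 (snd i)))); [|comp_auto].
    intros i; unfold Q, tower_oracle, join; pairs; intuition lia. }
  assert (HA : dec (ext D) (fun i => tower (S (m (fst i))) (snd i))).
  { apply (dec_iff (ext D) (fun i => Q (fst i) (pair_nat 0 (snd i)))); [|comp_auto].
    intros i; unfold Q, tower_oracle, join; pairs; intuition lia. }
  apply (dec_iff D (fun i => verdict (m i) (S (q i)) (use_bound (m i) (S (q i))))).
  { intros i; rewrite jump_tower_satisfied; apply verdict_satisfied, use_bound_spec. }
  apply dec_verdict; auto; [comp_auto|].
  apply comp_use_bound; auto; comp_auto.
Qed.

(** Level [m + 1] is computable from the jump of level [m]: column [z + 1] is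
    eventually empty or eventually full, and the jump can search for a point
    beyond which it is constant. *)
Lemma dec_next_tower C m x :
  dec (ext C) (fun i => tower_oracle (m (fst i)) (snd i)) -> comp C m -> comp C x ->
  dec (jctx C) (fun i => tower_oracle (S (m i)) (x i)).
Proof.
  intros HO Hm Hx.
  set (Q := fun i => tower_oracle (m i)).
  change (dec (ext C) (fun i => Q (fst i) (snd i))) in HO.
  set (KQ := fun i => zero_jump (m i)). set (AQ := fun i => tower (m i)).
  assert (HK : dec (ext C) (fun i => KQ (fst i) (snd i))).
  { apply (dec_iff (ext C) (fun i => Q (fst i) (pair_nat 1 (snd i)))); [|comp_auto].
    intros i; unfold Q, KQ, tower_oracle, join; pairs; intuition lia. }
  assert (HA : dec (ext C) (fun i => AQ (fst i) (snd i))).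
  { apply (dec_iff (ext C) (fun i => Q (fst i) (pair_nat 0 (snd i)))); [|comp_auto].
    intros i; unfold Q, AQ, tower_oracle, join; pairs; intuition lia. }
  pose proof (comp_jump C m Hm) as Jm; pose proof (comp_jump C x Hx) as Jx.
  set (z := fun i => psnd (x i)).
  assert (Hz : comp C z) by (unfold z; comp_auto).
  pose proof (comp_jump C z Hz) as Jz.
  assert (H1 : dec (jctx C) (fun i => zero_jump (S (m i)) (z i))).
  { apply dec_jump_sd; exact (sd_jump_of C KQ z HK Hz). }
  assert (H2 : dec (jctx C) (fun i => tower (S (m i)) (z i))).
  { set (in_tail := fun i W => exists x, W <= x /\ pfst x = S (z i) /\ AQ i x).
    set (out_tail := fun i W => exists x, W <= x /\ pfst x = S (z i) /\ ~ AQ i x).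
    assert (Hin : dec (ext (jctx C)) (fun i => in_tail (fst i) (snd i))).
    { apply (dec_jump_sd (ext C) (fun i => in_tail (fst i) (snd i))).
      apply (sd_ex (ext C) (fun i x => snd i <= x /\ pfst x = S (z (fst i)) /\ AQ (fst i) x)).
      comp_auto. }
    assert (Hout : dec (ext (jctx C)) (fun i => out_tail (fst i) (snd i))).
    { apply (dec_jump_sd (ext C) (fun i => out_tail (fst i) (snd i))).
      apply (sd_ex (ext C) (fun i x => snd i <= x /\ pfst x = S (z (fst i)) /\ ~ AQ (fst i) x)).
      comp_auto. }
    assert (HW : forall i, exists W, ~ in_tail i W \/ ~ out_tail i W).
    { intros i; destruct (classic (tower (S (m i)) (z i))) as [H'|H'].
      - apply Hp, column_finite in H'; destruct H' as [M HM]; exists M; left.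
        intros (y & Hy & Hc & HAy); specialize (HM y Hc HAy); lia.
      - exists (use_bound (m i) (S (z i))); right; intros (y & Hy & Hc & HAy); apply HAy.
        apply (column_cofinite (zero_jump (m i)) p (m i) (z i) (use_bound (m i) (S (z i)))); auto.
        + now rewrite Hp.
        + apply use_bound_spec. }
    set (W := fun i => least (fun W => ~ in_tail i W \/ ~ out_tail i W)).
    assert (HWc : comp (jctx C) W).
    { apply (comp_least (jctx C) (fun i W => ~ in_tail i W \/ ~ out_tail i W)); auto.
      comp_auto. }
    apply (dec_iff (jctx C) (fun i => ~ in_tail i (W i))); [|comp_auto].
    intros i; destruct (HW i) as [W0 HW0].
    destruct (least_spec (fun W => ~ in_tail i W \/ ~ out_tail i W) W0 HW0) as [HWi _]; fold (W i) in HWi.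
    split; intros H'.
    - apply NNPP; intros HN.
      set (N := use_bound (m i) (S (z i))).
      apply H'; exists (pair_nat (S (z i)) (W i + N)).
      pose proof (pair_le_sum (S (z i)) (W i + N)); pairs; repeat split; [lia|].
      apply (column_cofinite (zero_jump (m i)) p (m i) (z i) N).
      + now rewrite Hp.
      + apply use_bound_spec.
      + apply pfst_pair.
      + lia.
    - destruct HWi as [|HWi]; auto.
      apply Hp, column_finite in H'; destruct H' as [M HM].
      exfalso; apply HWi; exists (pair_nat (S (z i)) (W i + M)).
      pose proof (pair_le_sum (S (z i)) (W i + M)); pairs; repeat split; [lia|].
      intros HAy; specialize (HM _ (pfst_pair _ _) HAy); lia. }
  set (P1 := fun i => zero_jump (S (m i)) (z i)) in H1.
  set (P2 := fun i => tower (S (m i)) (z i)) in H2.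
  apply (dec_iff (jctx C) (fun i => (pfst (x i) = 0 /\ P2 i) \/ (0 < pfst (x i) /\ P1 i)));
    [intros; reflexivity|].
  assert (forall P, dec (jctx C) P -> comp (jctx C) (fun i => chi (P i))) as E by auto.
  comp_auto; assumption.
Qed.

End Family.

(** * The jumps of the bottom set *)
Definition step_idx (P Q : nat -> nat -> Prop) : Type := idx (step_ctx P Q).
Definition step_n P Q (t : step_idx P Q) : nat := fst (fst (proj1_sig t)).
Definition step_m P Q (t : step_idx P Q) : nat := snd (fst (proj1_sig t)).
Definition step_x P Q (t : step_idx P Q) : nat := snd (proj1_sig t).

Lemma step_vars P Q (R : step_idx P Q -> nat -> Prop) :
  let C := Ctx (step_idx P Q) R (inp (step_ctx P Q)) in
  comp C (step_n P Q) /\ comp C (step_m P Q) /\ comp C (step_x P Q).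
Proof.
  intros C; repeat split.
  - apply (comp_eq C (fun t => pfst (pfst (inp C t)))); [|comp_auto].
    intros t; cbn; pairs; reflexivity.
  - apply (comp_eq C (fun t => psnd (pfst (inp C t)))); [|comp_auto].
    intros t; cbn; pairs; reflexivity.
  - apply (comp_eq C (fun t => psnd (inp C t))); [|comp_auto].
    intros t; cbn; pairs; reflexivity.
Qed.

Lemma step_dec P Q :
  dec (ext (Ctx (step_idx P Q) (fun t => Q (step_m P Q t)) (inp (step_ctx P Q))))
    (fun i => P (step_m P Q (fst i)) (snd i)).
Proof.
  set (C := Ctx _ _ _); destruct (step_vars P Q (orc C)) as (Hn & _ & _).
  apply (comp_Phi (ext C) (orc (ext C)) (fun i => step_n P Q (fst i)) snd).
  - exact (dec_orc (ext (ext C)) snd (comp_var _)).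
  - apply (comp_ext C (fun i => step_n P Q (fst i))); auto.
  - apply comp_var.
  - intros [[[[n m] x] Hg] y]; apply Hg.
Qed.

Section Levels.

Variable p : nat.
Hypothesis Hp : forall m z, next_set (zero_jump m) p m z <-> tower p (S m) z.

(** Step: a reduction of [jumps m] to level [m] gives one of [jumps (m + 1)] to
    the jump of level [m], which is computable from level [m + 1]. *)
Lemma jumps_from_tower :
  dec (level_ctx (tower_oracle p)) (fun t => jumps (fst t) (tower p 0) (snd t)).
Proof.
  apply (uniform_iteration (fun m => jumps m (tower p 0)) (tower_oracle p)).
  - set (C := Ctx _ _ _).
    apply (dec_iff C (fun x => orc C x (pair_nat 0 (inp C x)))).
    + intros x; cbn; unfold tower_oracle, join; pairs; intuition lia.
    + apply dec_orc; comp_auto.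
  - set (P := fun m => jumps m (tower p 0)); set (Q := tower_oracle p).
    change (dec (step_ctx P Q) (fun t => jump (P (step_m P Q t)) (step_x P Q t))).
    pose proof (step_dec P Q) as HP.
    destruct (step_vars P Q (fun t => Q (step_m P Q t))) as (_ & Hm & Hx).
    set (C := Ctx _ _ _) in *.
    pose proof (dec_jump_sd C _ (sd_jump_of C (fun t => P (step_m P Q t)) _ HP Hx)) as H.
    apply (comp_trans (jctx C) (fun t => Q (S (step_m P Q t))) (inp (step_ctx P Q))).
    + destruct (step_vars P Q (orc (step_ctx P Q))) as (_ & Hm' & _).
      change (comp (step_ctx P Q) (step_m P Q)) in Hm'.
      apply (dec_jump_tower p Hp (ext (step_ctx P Q)) (fun i => step_m P Q (fst i)) snd).
      * exact (dec_orc (ext (ext (step_ctx P Q))) snd (comp_var _)).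
      * exact (comp_ext (step_ctx P Q) (fun i => step_m P Q (fst i)) (fun _ _ _ => eq_refl) Hm').
      * apply comp_var.
    + apply (comp_inp (step_ctx P Q)).
    + exact H.
Qed.

(** Step: level [m + 1] is computable from the jump of level [m], and that jump
    from [jumps (m + 1)]. *)
Lemma tower_from_jumps :
  dec (level_ctx (fun m => jumps m (tower p 0))) (fun t => tower_oracle p (fst t) (snd t)).
Proof.
  apply (uniform_iteration (tower_oracle p) (fun m => jumps m (tower p 0))).
  - set (C := Ctx _ _ _).
    apply (dec_iff C (fun x => pfst (inp C x) = 0 /\ orc C x (psnd (inp C x)))).
    + intros x; cbn; unfold tower_oracle, join; unfold zero_jump, emptyset; cbn; intuition lia.
    + assert (dec C (fun x => orc C x (psnd (inp C x)))) by (apply dec_orc; comp_auto).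
      apply dec_and; [comp_auto|auto].
  - set (P := tower_oracle p); set (Q := fun m => jumps m (tower p 0)).
    change (dec (step_ctx P Q) (fun t => P (S (step_m P Q t)) (step_x P Q t))).
    pose proof (step_dec P Q) as HP.
    set (C1 := Ctx _ _ _) in HP.
    set (C := Ctx (step_idx P Q) (fun t => P (step_m P Q t)) (inp (step_ctx P Q))).
    destruct (step_vars P Q (orc C)) as (_ & Hm & Hx).
    assert (H : dec (jctx C) (fun t => P (S (step_m P Q t)) (step_x P Q t))).
    { apply (dec_next_tower p Hp C (step_m P Q) (step_x P Q)); auto.
      exact (dec_orc (ext C) snd (comp_var _)). }
    apply (comp_trans (jctx C) (fun t => Q (S (step_m P Q t))) (inp (step_ctx P Q))).
    + apply (dec_jump_sd (ext C1) (fun i => jump (P (step_m P Q (fst i))) (snd i))).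
      apply (sd_jump_of (ext C1) (fun i => P (step_m P Q (fst i))) snd); [|apply comp_var].
      apply (weaken C1 (fun t => P (step_m P Q t))), HP.
    + apply (comp_inp (step_ctx P Q)).
    + exact H.
Qed.

(** * The two diagonal sets *)
Definition diag_empty (n : nat) : Prop := Phi n (zero_jump n) n 0.
Definition diag_tower (n : nat) : Prop := Phi n (tower_oracle p n) n 0.

Definition nat_ctx (Q : nat -> nat -> Prop) : ctx := Ctx nat Q (fun n => n).

Lemma Delta_1_1 X S : Delta 1 1 X S <-> dec (nat_ctx (fun n => jumps n X)) S.
Proof.
  assert (E : forall n, 1 * n + 1 - 1 = n) by lia.
  split.
  - intros [e He].
    apply (comp_Phi (nat_ctx (fun n => jumps n X)) (fun n => jumps n X) (fun _ => e) (fun n => n)).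
    + exact (dec_orc (ext (nat_ctx _)) snd (comp_var _)).
    + apply comp_const.
    + apply comp_inp.
    + intros n; specialize (He n); rewrite E in He.
      unfold chi; destruct excluded_middle_informative; tauto.
  - intros [c Hc]; exists (encode c); intros n; rewrite E; specialize (Hc n); cbn in Hc.
    split; intros H; exists c; split; auto;
      [now rewrite chi_true in Hc|now rewrite chi_false in Hc].
Qed.

Lemma dec_level_diagonal P Q x :
  dec (level_ctx Q) (fun t => P (fst t) (snd t)) -> comp (nat_ctx Q) x ->
  dec (nat_ctx Q) (fun n => P n (x n)).
Proof.
  intros H Hx.
  refine (comp_sub (level_ctx Q) (nat_ctx Q) (fun n => (n, x n)) _ (fun _ => eq_refl) _ H).
  cbn; apply comp_pair; auto; apply (comp_inp (nat_ctx Q)).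
Qed.

(** The bit is stored as the element [0] of level [n]. *)
Lemma diag_empty_Delta : Delta 1 1 (tower p 0) diag_empty.
Proof.
  apply Delta_1_1; set (Q := fun n => jumps n (tower p 0)).
  apply (dec_iff (nat_ctx Q) (fun n => tower_oracle p n (pair_nat 0 0))).
  - intros n; unfold tower_oracle, join, diag_empty; pairs; unfold tower; rewrite limit_0, Phi_ev.
    intuition lia.
  - apply dec_level_diagonal; [apply tower_from_jumps|apply comp_const].
Qed.

Lemma diag_empty_not_Delta : ~ Delta 1 1 emptyset diag_empty.
Proof.
  intros H; apply Delta_1_1 in H; destruct H as [c Hc].
  specialize (Hc (encode c)); cbn in Hc.
  destruct (classic (diag_empty (encode c))) as [H|H].
  - rewrite chi_true in Hc by auto.
    assert (Phi (encode c) (zero_jump (encode c)) (encode c) 1) as H1 by (exists c; auto).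
    discriminate (Phi_functional _ _ _ _ _ H H1).
  - apply H; rewrite chi_false in Hc by auto; exists c; auto.
Qed.

(** A program with oracle [jumps n] of the bottom set becomes one with oracle
    level [n], whose code is then diagonalized against. *)
Lemma diag_tower_not_Delta : ~ Delta 1 1 (tower p 0) diag_tower.
Proof.
  intros H; apply Delta_1_1 in H.
  apply (comp_trans (nat_ctx (fun n => jumps n (tower p 0))) (tower_oracle p) (fun n => n)) in H; cycle 1.
  - refine (comp_sub (level_ctx (tower_oracle p)) (ext (nat_ctx (tower_oracle p))) (fun i => (fst i, snd i)) _
      (fun _ => eq_refl) _ jumps_from_tower).
    apply (comp_inp (ext (nat_ctx (tower_oracle p)))).
  - apply (comp_inp (nat_ctx (tower_oracle p))).
  - destruct H as [c Hc]; specialize (Hc (encode c)); cbn in Hc.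
    destruct (classic (diag_tower (encode c))) as [H|H].
    + rewrite chi_true in Hc by auto.
      assert (Phi (encode c) (tower_oracle p (encode c)) (encode c) 1) as H1 by (exists c; auto).
      discriminate (Phi_functional _ _ _ _ _ H H1).
    + apply H; rewrite chi_false in Hc by auto; exists c; auto.
Qed.

(** The question is requirement [0] of level [n]. *)
Lemma diag_tower_Delta : Delta 1 1 (jump emptyset) diag_tower.
Proof.
  apply Delta_1_1.
  assert (E : (fun n => jumps n (jump emptyset)) = fun n => zero_jump (S n)).
  { extensionality n; unfold zero_jump, jumps; induction n as [|n IH]; [reflexivity|].
    change (jump (Nat.iter n jump (jump emptyset)) = jump (Nat.iter (S n) jump emptyset)).
    now rewrite IH. }
  rewrite E; set (C := nat_ctx _).
  apply (dec_iff C (fun n => satisfied (zero_jump n) p n 0)).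
  - intros n; unfold diag_tower; rewrite Phi_ev; unfold satisfied, req; split; intros [u H];
      exists u; [destruct H as [[_ H]|[H _]]; [exact H|lia]|left; auto].
  - apply (dec_satisfied_0 p C (fun n => n)); [|exact (comp_inp C)].
    exact (dec_orc (ext C) snd (comp_var C)).
Qed.

Lemma tower_0_enumerable : computably_enumerable (tower p 0).
Proof.
  set (C := nat_ctx (fun _ => emptyset)).
  assert (sd C (tower p 0)) as [c Hc].
  { apply (sd_ex C (fun x s => enumerated (zero_jump 0) p 0 s x)).
    assert (dec (ext (ext C)) (fun i => (fun _ => emptyset) (fst i) (snd i))).
    { exact (dec_orc (ext (ext C)) snd (comp_var _)). }
    apply (dec_enumerated (ext C) (fun _ => emptyset) (fun _ => p) (fun _ => 0) snd fst); auto.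
    - apply comp_const.
    - apply comp_const.
    - apply comp_var.
    - apply (comp_ext C fst); auto; apply (comp_inp C). }
  exists (encode c); intros n; rewrite (Hc n); split; intros [y H]; exists y.
  - exists c; auto.
  - destruct H as (d & E & H); now apply encode_inj in E; subst d.
Qed.

End Levels.

Theorem theorem3p6 :
  exists A : nat -> Prop,
    computably_enumerable A /\ intermediate_for_Delta_Feiner A.
Proof.
  destruct self_reference as [c Hc].
  assert (Hp : forall m z, next_set (zero_jump m) (encode c) m z <-> tower (encode c) (S m) z).
  { intros m z; unfold next_set; rewrite conv_Phi.
    etransitivity; [|apply (Hc (zero_jump (S m)))]; split; intros [y H]; exists y.
    - destruct H as (d & E & H); now apply encode_inj in E; subst d.
    - exists c; auto. }
  exists (tower (encode c) 0); split; [apply tower_0_enumerable|].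
  exists 1, 1; split; [lia|]; split; intros H.
  - apply diag_empty_not_Delta, H, diag_empty_Delta; exact Hp.
  - apply (diag_tower_not_Delta (encode c) Hp), H, diag_tower_Delta.
Qed.
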